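(* Let $\xi$ be a model and $h\ge0$. Then $\sup_{\eta\in\mathcal{K}_{h,\xi}}D(\eta)$ is attained, i.e. $\sup_{\mathcal{K}_{h,\xi}}D=\max_{\mathcal{K}_{h,\xi}}D$, and the maximizer is unique.
   Context: A model is $\xi(t)=\sum_{p\ge2}\beta_p^2t^p$, real $\beta_p$ not all zero, with $\xi(1+\epsilon)<\infty$ for some $\epsilon>0$. $\mathcal{K}_{h,\xi}$ is the set of convex $\eta\in C([0,1])$ with $\eta\ge\xi$ on $[0,1]$, $\eta(1)=\xi(1)$ and right derivative $\eta'(0)=\xi'(0)-h^2$. $\eta''$ is the distributional second derivative (a nonnegative measure on $(0,1)$), $\eta''_{ac}$ the density of its absolutely continuous part, and $D(\eta)=2\int_0^1\sqrt{\eta''_{ac}(x)}dx$. *)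

(* Defs.v *)
From HB Require Import structures.
From mathcomp Require Import all_boot all_order all_algebra.
From mathcomp Require Import all_classical all_reals all_analysis.
Set Implicit Arguments. Unset Strict Implicit. Unset Printing Implicit Defensive.
Import Order.TTheory GRing.Theory Num.Theory.
Import numFieldNormedType.Exports.
Local Open Scope classical_set_scope.
Local Open Scope ring_scope.

Section Defs.
Variable R : realType.

Definition xi_partial (b : nat -> R) (t : R) (n : nat) : R :=
  \sum_(2 <= p < n) (b p ^+ 2 * t ^+ p).

Definition model_xi (b : nat -> R) (t : R) : R := limn (xi_partial b t).

Definition is_model (b : nat -> R) : Prop :=
  (exists p : nat, (2 <= p)%N /\ b p != 0) /\
  (exists eps : R, 0 < eps /\ cvgn (xi_partial b (1 + eps))).

Definition convex_on01 (eta : R -> R) : Prop :=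
  forall x y t : R, x \in `[0, 1] -> y \in `[0, 1] -> t \in `[0, 1] ->
    eta (t * x + (1 - t) * y) <= t * eta x + (1 - t) * eta y.

(* The class K_{h,xi}; functions are R -> R, only their values on [0,1] matter. *)
Definition K_class (b : nat -> R) (h : R) : set (R -> R) :=
  [set eta : R -> R | {within `[0, 1]%classic, continuous eta} /\ convex_on01 eta /\
     (forall x, x \in `[0, 1] -> model_xi b x <= eta x) /\
     eta 1 = model_xi b 1 /\
     ((fun t => (eta t - eta 0) / t) @ 0^'+ --> derive1 (model_xi b) 0 - h ^+ 2)].

Definition test_fun (phi : R -> R) : Prop :=
  (forall (n : nat) (x : R), derivable (derive1n n phi) x 1) /\
  exists a c : R, 0 < a /\ a < c /\ c < 1 /\
    (forall x, x < a \/ c < x -> phi x = 0).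

Definition second_dist_deriv (eta : R -> R)
    (mu : {measure set R -> \bar R}) : Prop :=
  mu (~` `]0, 1[%classic) = 0%E /\
  (forall a c : R, 0 < a -> c < 1 -> (mu `[a, c]%classic < +oo)%E) /\
  (forall phi : R -> R, test_fun phi ->
     (\int[lebesgue_measure]_(x in `[0%R, 1%R]%classic) (eta x * derive1n 2 phi x)%:E =
      \int[mu]_x (phi x)%:E)%E).

Definition leb_singular (nu : {measure set R -> \bar R}) : Prop :=
  exists N : set R, measurable N /\ lebesgue_measure N = 0%E /\ nu (~` N) = 0%E.

Definition ac_density (eta : R -> R) (g : R -> R) : Prop :=
  exists (mu nu : {measure set R -> \bar R}),
    second_dist_deriv eta mu /\ leb_singular nu /\
    (forall x, 0 <= g x) /\ measurable_fun setT g /\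
    (forall A : set R, measurable A ->
       mu A = (\int[lebesgue_measure]_(x in A) (g x)%:E + nu A)%E).

(* eta''_ac, chosen among the versions (all agree a.e.) *)
Definition eta2_ac (eta : R -> R) : R -> R :=
  xget (fun _ => 0) [set g | ac_density eta g].

Definition Dfun (eta : R -> R) : \bar R :=
  (2%:E * \int[lebesgue_measure]_(x in `[0%R, 1%R]%classic) (Num.sqrt (eta2_ac eta x))%:E)%E.

End Defs.

(* Main.v *)
(* Removing mass from eta'' raises eta, so among the eta in the class only the
   absolutely continuous part g of eta'' matters. Writing eta through the Green function
   G(x,y) = 1 - max(x,y) of the conditions at 0 and 1, the constraint eta >= xi reads
   int G(x,y) g(y) dy <= C(x), a convex condition on g >= 0 that bounds int g because
   xi is Lipschitz at 1. Quantitative strict concavity of the square root makes the square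
   roots of a maximizing sequence Cauchy in L^1; Fatou's lemma keeps the constraint in the
   limit, and the same inequality makes the maximal g unique almost everywhere. Finally, a
   maximizer eta has no singular part nu: since G(x,y) >= (1-x)(1-y), a nonzero nu could be
   traded for a small constant density, which strictly increases the functional. *)

(* The definition of [second_dist_deriv] tests [eta] only against smooth functions with compact
   support in ]0, 1[, and makes the measure finite a priori only on compact subintervals, whereas
   [green x] has a kink and stays positive down to 0. It is reached by an increasing sequence of
   piecewise linear tents, each a limit of smooth test functions; the slope at 0 and the value at 1
   appear as limits of the boundary terms. [D] is read off a density selected by [xget]. For the
   optimum this forces a uniqueness statement: whatever measure, singular part and density are
   selected, the Green integrals determine the measure, so the value of [D] is the same. For an
   arbitrary member of the class no density has to be produced: if there is none, the selected one
   is 0 and [D] is 0, which lies below the supremum because a small positive constant density is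
   feasible. The maximization uses no weak compactness. The average of two near-maximizers is
   feasible and cannot beat the supremum, so the gain from averaging is small, and this gain
   controls the distance of the roots. *)
Require Import Defs.
From HB Require Import structures.
From mathcomp Require Import all_boot all_order all_algebra.
From mathcomp Require Import all_classical all_reals all_analysis.
From mathcomp Require Import measurable_realfun ring lra.
Set Implicit Arguments. Unset Strict Implicit. Unset Printing Implicit Defensive.
Import Order.TTheory GRing.Theory Num.Theory.
Import numFieldNormedType.Exports.
Local Open Scope classical_set_scope.
Local Open Scope ring_scope.

(** * The function xi *)

Section CvgnHelpers.
Variable R : realType.
Implicit Types u v : nat -> R.

Lemma cvgn_Ml (a : R) u l : u @ \oo --> l -> (fun n => a * u n) @ \oo --> a * l.
Proof. by move=> ul; exact: cvgMl_tmp. Qed.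

Lemma cvgn_cst (a : R) : (fun _ : nat => a) @ \oo --> a.
Proof. exact: cvg_cst. Qed.

Lemma cvgn_B u v l m : u @ \oo --> l -> v @ \oo --> m -> (fun n => u n - v n) @ \oo --> l - m.
Proof. by move=> ul vm; exact: cvgB. Qed.

Lemma cvgn_le u v l m : u @ \oo --> l -> v @ \oo --> m ->
  (\forall n \near \oo, u n <= v n) -> l <= m.
Proof. by move=> ul vm; exact: ler_cvg_to. Qed.

End CvgnHelpers.
Arguments cvgn_Ml {R} a [u l].
Arguments cvgn_cst {R} a.

Section Model.
Variables (R : realType) (b : nat -> R).
Hypothesis Hb : is_model b.

Lemma xi_partial_series (t : R) :
  xi_partial b t = series (fun p => if (2 <= p)%N then b p ^+ 2 * t ^+ p else 0).
Proof.
apply/funext => n; rewrite /xi_partial /series /= (big_nat_widenl 2 0)//.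
by rewrite big_mkcond.
Qed.

(** Comparison with the series at [1 + eps], whose terms are nonnegative. The margin beyond 1 is
    what later bounds the slope of [xi] at 1. *)
Lemma model_radius : exists2 eps : R, 0 < eps &
  forall t, `|t| <= 1 + eps -> xi_partial b t @ \oo --> model_xi b t.
Proof.
case: Hb => _ [eps [eps0 cv]]; exists eps => // t ht.
suff: cvgn (xi_partial b t) by [].
rewrite xi_partial_series; apply: normed_cvg.
rewrite xi_partial_series in cv.
apply: series_le_cvg cv => n /=.
- by [].
- by case: ifP => // _; rewrite mulr_ge0 ?sqr_ge0 ?exprn_ge0//; lra.
- case: ifP => _; last by rewrite normr0.
  rewrite normrM (ger0_norm (sqr_ge0 _)) normrX.
  by rewrite ler_wpM2l ?sqr_ge0// lerXn2r ?nnegrE ?normr_ge0//; lra.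
Qed.

Lemma xi_partial_cvg (t : R) : `|t| <= 1 -> xi_partial b t @ \oo --> model_xi b t.
Proof. by case: model_radius => e e0 H t1; apply: H; lra. Qed.

(** The series starts at [p = 2], so a factor [t ^+ 2] comes out of every term. It yields both
    [xi 0 = 0] and a zero derivative at 0, which turns the slope prescribed in [K_class] into
    [- h ^+ 2]. *)
Lemma model_xi_quadratic (t : R) : `|t| <= 1 -> `|model_xi b t| <= t ^+ 2 * model_xi b 1.
Proof.
move=> t1.
have c1 := xi_partial_cvg t1.
have c2 : xi_partial b 1 @ \oo --> model_xi b 1 by apply: xi_partial_cvg; rewrite normr1.
have c3 : (fun n => `|xi_partial b t n|) @ \oo --> `|model_xi b t| by exact: cvg_norm.
apply: (cvgn_le c3 (cvgn_Ml (t ^+ 2) c2)).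
apply: nearW => n; rewrite /xi_partial /= mulr_sumr.
apply: (le_trans (ler_norm_sum _ _ _)).
rewrite big_nat_cond [leRHS]big_nat_cond; apply: ler_sum => p /andP[/andP[p2 _] _].
rewrite expr1n mulr1 normrM (ger0_norm (sqr_ge0 _)) normrX mulrC ler_wpM2r ?sqr_ge0//.
rewrite -[t ^+ 2]real_normK ?num_real//.
by case: p p2 => [|[|p]]// _; rewrite -addn2 exprD -[leRHS]mul1r ler_wpM2r ?exprn_ge0// exprn_ile1.
Qed.

Lemma model_xi0 : model_xi b 0 = 0.
Proof.
have := @model_xi_quadratic 0; rewrite normr0 => /(_ ler01).
by rewrite expr0n /= mul0r normr_le0 => /eqP.
Qed.

Lemma derive1_model_xi0 : derive1 (model_xi b) 0 = 0.
Proof.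
rewrite /derive1; apply/cvg_lim => //.
have x1 : 0 <= model_xi b 1.
  have := @model_xi_quadratic 1; rewrite normr1 lexx expr1n mul1r => /(_ isT).
  exact: le_trans.
apply/cvgrPdist_le => e e0; near=> t.
have t0 : t != 0 by near: t; exact: nbhs_dnbhs_neq.
have t1 : `|t| <= 1 by near: t; exact: dnbhs0_le.
have te : `|t| <= e / (model_xi b 1 + 1).
  by near: t; apply: dnbhs0_le; rewrite divr_gt0//; lra.
rewrite sub0r normrN addr0 model_xi0 subr0 normrM normfV.
have -> : e = `|t|^-1 * (`|t| * e) by rewrite mulKf ?normr_eq0.
rewrite ler_wpM2l ?invr_ge0//; apply: (le_trans (model_xi_quadratic t1)).
rewrite -[t ^+ 2]real_normK ?num_real// expr2 -mulrA ler_wpM2l//.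
apply: (@le_trans _ _ (`|t| * (model_xi b 1 + 1))); first by rewrite ler_wpM2l//; lra.
by rewrite -ler_pdivlMr//; lra.
Unshelve. all: by end_near. Qed.

Lemma model_xi_ge0 (t : R) : 0 <= t <= 1 -> 0 <= model_xi b t.
Proof.
move=> /andP[t0 t1].
have c1 := @xi_partial_cvg t; rewrite ger0_norm// in c1.
apply: (cvgn_le (cvgn_cst 0) (c1 t1)); apply: nearW => n.
by apply: sumr_ge0 => p _; rewrite mulr_ge0 ?sqr_ge0 ?exprn_ge0.
Qed.

Lemma bernoulli_ineq (x : R) n : 0 <= x -> 1 + n%:R * x <= (1 + x) ^+ n.
Proof.
move=> x0; elim: n => [|n IH]; first by rewrite mul0r addr0 expr0.
rewrite exprS -natr1.
apply: (@le_trans _ _ ((1 + x) * (1 + n%:R * x))); last by rewrite ler_wpM2l//; lra.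
have : 0 <= n%:R * x * x by rewrite !mulr_ge0.
lra.
Qed.

Lemma subr_expr_le (t : R) n : 0 <= t <= 1 -> 1 - t ^+ n <= n%:R * (1 - t).
Proof.
move=> /andP[t0 t1]; elim: n => [|n IH]; first by rewrite expr0 mul0r subrr.
rewrite exprS -natr1.
have : 1 - t ^+ n <= n%:R * (1 - t) by [].
have : 0 <= t ^+ n <= 1 by rewrite exprn_ge0//= exprn_ile1.
nra.
Qed.

(** The constant is the slope of the chord of [xi] from 1 to [1 + e], which by convexity dominates
    the chords ending at 1. Term by term this is [1 - t ^+ p <= p (1 - t)] combined with
    [p e <= (1 + e) ^+ p - 1]. *)
Lemma model_xi_lipschitz1 : exists2 L : R, 0 <= L &
  forall t, 0 <= t <= 1 -> model_xi b 1 - model_xi b t <= L * (1 - t).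
Proof.
have [e e0 He] := model_radius.
have c1 : xi_partial b 1 @ \oo --> model_xi b 1 by apply: xi_partial_cvg; rewrite normr1.
have ce : xi_partial b (1 + e) @ \oo --> model_xi b (1 + e).
  by apply: He; rewrite ger0_norm//; lra.
exists ((model_xi b (1 + e) - model_xi b 1) / e).
  apply: divr_ge0; last lra.
  rewrite subr_ge0; apply: (cvgn_le c1 ce); apply: nearW => n.
  apply: ler_sum => p _; rewrite ler_wpM2l ?sqr_ge0// lerXn2r ?nnegrE//; lra.
move=> t t01; move: (t01) => /andP[t0 t1].
have ct : xi_partial b t @ \oo --> model_xi b t by apply: xi_partial_cvg; rewrite ger0_norm.
rewrite -(ler_pM2l e0) mulrA mulrCA divff ?gt_eqF// mulr1.
rewrite [leRHS]mulrC.
apply: (cvgn_le (cvgn_Ml e (cvgn_B c1 ct)) (cvgn_Ml (1 - t) (cvgn_B ce c1))).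
apply: nearW => n /=; rewrite -!sumrB !mulr_sumr; apply: ler_sum => p _.
rewrite -!mulrBr !(mulrCA _ (b p ^+ 2)) ler_wpM2l ?sqr_ge0// expr1n.
have h1 := subr_expr_le p t01.
have h2 := @bernoulli_ineq e p (ltW e0).
have : (1 - t ^+ p) * e <= (p%:R * (1 - t)) * e by rewrite ler_wpM2r// ltW.
have : (1 - t) * (p%:R * e) <= (1 - t) * ((1 + e) ^+ p - 1) by rewrite ler_wpM2l//; lra.
lra.
Qed.

(** One nonzero coefficient suffices, since [1 - t ^+ p >= 1 - t]. This leaves room for a positive
    constant density, hence makes the supremum positive. *)
Lemma model_xi_gap : exists2 c : R, 0 < c &
  forall t, 0 <= t <= 1 -> c * (1 - t) <= model_xi b 1 - model_xi b t.
Proof.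
have [p [p2 bp]] := Hb.1.
have c1 : xi_partial b 1 @ \oo --> model_xi b 1 by apply: xi_partial_cvg; rewrite normr1.
exists (b p ^+ 2) => [|t]; first by rewrite exprn_even_gt0//= bp orbT.
move=> /andP[t0 t1].
have ct : xi_partial b t @ \oo --> model_xi b t by apply: xi_partial_cvg; rewrite ger0_norm.
apply: (cvgn_le (cvgn_cst _) (cvgn_B c1 ct)).
exists p.+1 => // n /= pn.
rewrite -sumrB (bigD1_seq p)/=; last 2 first.
  by rewrite mem_index_iota p2.
  by rewrite iota_uniq.
apply: ler_wpDr.
  apply: sumr_ge0 => q _; rewrite -mulrBr mulr_ge0 ?sqr_ge0// expr1n subr_ge0.
  by rewrite exprn_ile1.
rewrite -mulrBr ler_wpM2l ?sqr_ge0// expr1n lerB//.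
rewrite -(subnK p2) addn2 exprSr -[leRHS]mul1r ler_wpM2r// exprn_ile1//.
Qed.

End Model.

(** * Smooth functions *)

Section Smooth.
Variable R : realType.
Implicit Types (f g : R -> R) (p : {poly R}).

(* flat p x = p(1/x) exp(-1/x) for x > 0; this family is stable under derivation *)
Definition flat p (x : R) : R := if 0 < x then p.[x^-1] * expR (- x^-1) else 0.

Lemma expr_expRN_bound n (y : R) : 0 <= y -> y ^+ n * expR (- y) <= n`!%:R.
Proof.
move=> y0; rewrite expRN ler_pdivrMr ?expR_gt0//.
case: n => [|n]; first by rewrite expr0 fact0 mul1r; apply: le_trans (expR_ge1Dx y); lra.
rewrite mulrC -ler_pdivrMr ?ltr0n ?fact_gt0//.
by apply: le_trans (expR_ge1Dxn n y0); lra.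
Qed.

Lemma horner_expRN_bound p : exists2 C : R, 0 <= C &
  forall y, 0 <= y -> `|p.[y] * expR (- y)| <= C.
Proof.
exists (\sum_(i < size p) `|p`_i| * i`!%:R).
  by apply: sumr_ge0 => i _; rewrite mulr_ge0.
move=> y y0; rewrite horner_coef mulr_suml.
apply: (le_trans (ler_norm_sum _ _ _)); apply: ler_sum => i _.
rewrite -mulrA normrM ler_wpM2l// ger0_norm ?expr_expRN_bound//.
by rewrite mulr_ge0 ?exprn_ge0 ?expR_ge0.
Qed.

Lemma is_derive_flat p (x : R) : is_derive x 1 (flat p) (flat ('X^2 * (p - p^`())) x).
Proof.
have [x0|x0|->] := ltgtP x 0.
- apply: (@near_eq_is_derive _ _ _ (cst (0 : R))).
    by near=> y; rewrite /flat ifF//; apply/negbTE; rewrite -leNgt ltW//; near: y; exact: lt_nbhsl.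
  by apply: (is_derive_eq (is_derive_cst _ _ _)); rewrite /flat ifF//; apply/negbTE;
    rewrite -leNgt ltW.
- apply: (@near_eq_is_derive _ _ _ (fun y : R => p.[y^-1] * expR (- y^-1))).
    by near=> y; rewrite /flat ifT//; near: y; exact: lt_nbhsr.
  have xn0 : x != 0 by rewrite gt_eqF.
  have dV : is_derive x 1 (fun y : R => y^-1) (- x ^- 2 *: 1).
    exact: (@is_deriveV _ (fun y => y)).
  have dp : is_derive x 1 (fun y : R => p.[y^-1]) (p^`().[x^-1] * (- x ^- 2 *: 1)).
    exact: (@is_derive1_comp _ (horner p) (fun y : R => y^-1)).
  have de : is_derive x 1 (fun y : R => expR (- y^-1)) (expR (- x^-1) * (- (- x ^- 2 *: 1))).
    exact: (@is_derive1_comp _ expR (fun y : R => - y^-1)).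
  have dm := @is_deriveM _ _ _ _ _ _ _ _ dp de.
  apply: (is_derive_eq dm).
  rewrite /flat x0 !hornerE /= -![_ *: _]/(_ * _).
  by rewrite -exprVn; ring.
- have -> : flat ('X^2 * (p - p^`())) 0 = 0 by rewrite /flat ltxx.
  (* For [h > 0] the difference quotient at 0 is [h] times the function of ['X^2 * p] at [1 / h],
     and that factor is bounded. *)
  have [C C0 HC] := horner_expRN_bound ('X^2 * p).
  have L : (fun h : R => h^-1 *: (flat p (h *: 1 + 0) - flat p 0)) @ 0^' --> (0:R).
    apply/cvgrPdist_le => e e0; near=> h.
    have he : `|h| <= e / (C + 1) by near: h; apply: dnbhs0_le; rewrite divr_gt0//; lra.
    rewrite sub0r normrN /= addr0 -![_ *: _]/(_ * _) mulr1 /flat ltxx subr0.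
    case: ifPn => [h0|_]; last by rewrite mulr0 normr0 ltW.
    have := HC h^-1; rewrite invr_ge0 ltW// => /(_ isT).
    rewrite hornerM hornerXn -mulrA normrM => Hh.
    apply: (@le_trans _ _ (`|h| * C)).
      apply: le_trans (ler_wpM2l (normr_ge0 h) Hh).
      rewrite normrM !normrX normfV le_eqVlt; apply/orP; left; apply/eqP.
      by field; rewrite normr_eq0 gt_eqF.
    apply: (@le_trans _ _ (`|h| * (C + 1))); first by rewrite ler_wpM2l//; lra.
    by rewrite -ler_pdivlMr//; lra.
  by apply: DeriveDef; [apply/cvg_ex; exists 0|apply/cvg_lim].
Unshelve. all: by end_near. Qed.

(** A syntactic class closed under derivation: derivability at every order follows by iterating one
    step, with no formula for higher derivatives of products or inverses. *)
Inductive smooth_expr : (R -> R) -> Prop :=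
| smooth_cst c : smooth_expr (fun _ => c)
| smooth_id : smooth_expr (fun x => x)
| smooth_flat p : smooth_expr (flat p)
| smooth_add f g : smooth_expr f -> smooth_expr g -> smooth_expr (fun x => f x + g x)
| smooth_mul f g : smooth_expr f -> smooth_expr g -> smooth_expr (fun x => f x * g x)
| smooth_inv f : (forall x, f x != 0) -> smooth_expr f -> smooth_expr (fun x => (f x)^-1)
| smooth_aff f a c : smooth_expr f -> smooth_expr (fun x => f (a * x + c)).

Lemma smooth_expr_derive f : smooth_expr f ->
  exists2 g, smooth_expr g & forall x : R, is_derive x 1 f (g x).
Proof.
elim => {f}.
- move=> c; exists (fun _ => 0); first exact: smooth_cst.
  by move=> x; exact: is_derive_cst.
- exists (fun _ => 1); first exact: smooth_cst.
  by move=> x; exact: is_derive_id.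
- move=> p; exists (flat ('X^2 * (p - p^`()))); first exact: smooth_flat.
  by move=> x; exact: is_derive_flat.
- move=> f g sf [f' sf' df] sg [g' sg' dg].
  exists (fun x => f' x + g' x); first exact: smooth_add.
  by move=> x; exact: is_deriveD.
- move=> f g sf [f' sf' df] sg [g' sg' dg].
  exists (fun x => f x * g' x + g x * f' x).
    by apply: smooth_add; apply: smooth_mul.
  by move=> x; exact: is_deriveM.
- move=> f f0 sf [f' sf' df].
  exists (fun x => (- 1) * ((f x)^-1 * (f x)^-1) * f' x).
    do ![apply: smooth_mul => //]; first exact: smooth_cst.
      exact: smooth_inv.
    exact: smooth_inv.
  move=> x; have d1 := @is_deriveV _ f x (f' x) 1 (f0 x) (df x).
  by apply: (is_derive_eq d1); rewrite -[_ *: _]/(_ * _) -exprVn expr2 mulN1r.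
- move=> f a c sf [f' sf' df].
  exists (fun x => a * f' (a * x + c)).
    by apply: smooth_mul; [exact: smooth_cst|exact: smooth_aff].
  move=> x.
  have d1 : is_derive x 1 (fun x : R => a * x + c) a.
    have d1 := @is_deriveD _ _ _ _ _ x 1 _ _ (@is_deriveZ _ _ _ _ a x 1 _ (is_derive_id x 1))
      (is_derive_cst c x 1).
    by apply: (is_derive_eq d1); rewrite addr0 -[_ *: _]/(_ * _) mulr1.
  have d2 := @is_derive1_comp _ f _ x _ _ (df _) d1.
  by apply: (is_derive_eq d2); rewrite mulrC.
Qed.

Lemma smooth_expr_derive1 f : smooth_expr f -> smooth_expr (derive1 f).
Proof.
move=> /smooth_expr_derive[g sg df].
suff -> : derive1 f = g by [].
by apply/funext => x; rewrite derive1E; apply: derive_val.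
Qed.

Lemma smooth_expr_derivable f : smooth_expr f ->
  forall n (x : R), derivable (derive1n n f) x 1.
Proof.
move=> sf n x; suff : smooth_expr (derive1n n f).
  by case/smooth_expr_derive => g _ /(_ x) [].
by elim: n => // n IH; rewrite derive1nS; exact: smooth_expr_derive1.
Qed.

Lemma smooth_expr_is_derive f (x : R) : smooth_expr f -> is_derive x 1 f (derive1 f x).
Proof.
by case/smooth_expr_derive => g _ df; rewrite derive1E; apply: DeriveDef => //; have [] := df x.
Qed.

End Smooth.

(** * Mollified positive part *)

Section SoftRamp.
Variable R : realType.
Implicit Types (f g : R -> R).

Let bump (x : R) : R := flat 1 (1 + x).

Let bump_ge0 x : 0 <= bump x.
Proof. by rewrite /bump /flat; case: ifP => // _; rewrite hornerC mul1r expR_ge0. Qed.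

Let bump_gt0 x : -1 < x -> 0 < bump x.
Proof. by move=> x1; rewrite /bump /flat ifT; [rewrite hornerC mul1r expR_gt0|lra]. Qed.

Let bump0 x : x <= -1 -> bump x = 0.
Proof. by move=> x1; rewrite /bump /flat ifF//; apply/negbTE; rewrite -leNgt; lra. Qed.

Let bump_sum_gt0 x : 0 < bump x + bump (- x).
Proof.
have [x0|x0] := leP 0 x.
  by rewrite ltr_pwDl// bump_gt0//; lra.
by rewrite ltr_wpDl// bump_gt0//; lra.
Qed.

(** Since [bump] is positive exactly to the right of -1, the quotient is a smooth step, 0 up to -1
    and 1 from 1 on. The product with [x] is a smooth positive part, exact outside ]-1, 1[. *)
Definition soft_ramp (x : R) : R := x * (bump x * (bump x + bump (- x))^-1).

Lemma soft_ramp_smooth : smooth_expr soft_ramp.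
Proof.
have sb : smooth_expr bump.
  suff -> : bump = (fun x => flat 1 (1 * x + 1)) by apply: smooth_aff; exact: smooth_flat.
  by apply/funext => x; rewrite /bump mul1r addrC.
have sbN : smooth_expr (fun x => bump (- x)).
  suff -> : (fun x => bump (- x)) = (fun x => bump (-1 * x + 0)) by exact: smooth_aff.
  by apply/funext => x; rewrite mulN1r addr0.
apply: smooth_mul; first exact: smooth_id.
apply: smooth_mul => //; apply: smooth_inv; last exact: smooth_add.
by move=> x; rewrite gt_eqF.
Qed.

Lemma soft_ramp_left x : x <= -1 -> soft_ramp x = 0.
Proof. by move=> x1; rewrite /soft_ramp bump0// mul0r mulr0. Qed.

Lemma soft_ramp_right x : 1 <= x -> soft_ramp x = x.
Proof.
move=> x1; rewrite /soft_ramp (bump0 (x := - x)); last lra.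
by rewrite addr0 divff ?mulr1// gt_eqF// bump_gt0//; lra.
Qed.

Lemma soft_ramp_close x : `|soft_ramp x - Num.max x 0| <= 1.
Proof.
have [x1|x1] := leP x (-1).
  by rewrite soft_ramp_left// max_r ?subrr ?normr0//; lra.
have [x2|x2] := leP 1 x.
  by rewrite soft_ramp_right// max_l ?subrr ?normr0//; lra.
rewrite /soft_ramp; set th := bump x * _.
have th0 : 0 <= th by rewrite mulr_ge0 ?bump_ge0// invr_ge0 ltW.
have th1 : th <= 1 by rewrite /th ler_pdivrMr// mul1r lerDl.
have [x0|x0] := leP 0 x.
  by rewrite ler_norml; nra.
by rewrite ler_norml; nra.
Qed.

Lemma derive1_aff f a c : smooth_expr f ->
  derive1 (fun y => f (a * y + c)) = (fun y => a * derive1 f (a * y + c)).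
Proof.
move=> /smooth_expr_derive[g sg df].
have -> : derive1 f = g.
  by apply/funext => x; rewrite derive1E; apply: derive_val.
apply/funext => x; rewrite derive1E.
have d1 : is_derive x 1 (fun x : R => a * x + c) a.
  have d1 := @is_deriveD _ _ _ _ _ x 1 _ _ (@is_deriveZ _ _ _ _ a x 1 _ (is_derive_id x 1))
    (is_derive_cst c x 1).
  by apply: (is_derive_eq d1); rewrite addr0 -[_ *: _]/(_ * _) mulr1.
have d2 := @is_derive1_comp _ f _ x _ _ (df _) d1.
by rewrite (@derive_val _ _ _ _ _ _ _ d2) mulrC.
Qed.

Lemma derive1_scale f a : smooth_expr f ->
  derive1 (fun y => a * f y) = (fun y => a * derive1 f y).
Proof.
move=> /smooth_expr_derive[g sg df].
have -> : derive1 f = g.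
  by apply/funext => x; rewrite derive1E; apply: derive_val.
apply/funext => x; rewrite derive1E.
exact: (@derive_val _ _ _ _ _ _ _ (@is_deriveZ _ _ _ f a x 1 _ (df x))).
Qed.

Lemma derive1_add f g : smooth_expr f -> smooth_expr g ->
  derive1 (fun y => f y + g y) = (fun y => derive1 f y + derive1 g y).
Proof.
move=> sf sg; apply/funext => x; rewrite derive1E.
exact: (@derive_val _ _ _ _ _ _ _ (@is_deriveD _ _ _ _ _ x 1 _ _ (smooth_expr_is_derive x sf)
  (smooth_expr_is_derive x sg))).
Qed.

Lemma smooth_expr_continuous f : smooth_expr f -> continuous f.
Proof.
move=> sf x; apply: differentiable_continuous; apply/derivable1_diffP.
by have [] := smooth_expr_is_derive x sf.
Qed.

Lemma near_eq_derive1 f g (x : R) : (\near x, f x = g x) -> derive1 f x = derive1 g x.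
Proof. by move=> fg; rewrite !derive1E; exact: near_eq_derive. Qed.

Lemma derive1_affine (a c x : R) : derive1 (fun y => a * y + c) x = a.
Proof.
have sid := smooth_id R.
rewrite (derive1_add (f := fun y => a * y) (g := fun=> c)); last 2 first.
  by apply: smooth_mul; [exact: smooth_cst|].
  exact: smooth_cst.
rewrite derive1_scale// !derive1E derive_id derive_cst; lra.
Qed.

Lemma derive1_soft_ramp_left x : x < -1 -> derive1 soft_ramp x = 0.
Proof.
move=> x1; rewrite (@near_eq_derive1 _ (fun y => 0 * y + 0)) ?derive1_affine//.
near=> y; rewrite mul0r addr0 soft_ramp_left// ltW//; near: y; exact: lt_nbhsl.
Unshelve. all: by end_near. Qed.

Lemma derive1_soft_ramp_right x : 1 < x -> derive1 soft_ramp x = 1.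
Proof.
move=> x1; rewrite (@near_eq_derive1 _ (fun y => 1 * y + 0)) ?derive1_affine//.
near=> y; rewrite mul1r addr0 soft_ramp_right// ltW//; near: y; exact: lt_nbhsr.
Unshelve. all: by end_near. Qed.

Lemma derive2_soft_ramp_out x : 1 < `|x| -> derive1n 2 soft_ramp x = 0.
Proof.
rewrite lter_normr => /orP[x1|x1]; rewrite derive1nS derive1n1.
  rewrite (@near_eq_derive1 _ (fun y => 0 * y + 1)) ?derive1_affine//.
  near=> y; rewrite mul0r add0r derive1_soft_ramp_right//; near: y; exact: lt_nbhsr.
rewrite (@near_eq_derive1 _ (fun y => 0 * y + 0)) ?derive1_affine//.
near=> y; rewrite mul0r add0r derive1_soft_ramp_left//; near: y; apply: lt_nbhsl; lra.
Unshelve. all: by end_near. Qed.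

(** The second derivative is continuous and vanishes outside [-1, 1], so compactness of that
    interval is enough. *)
Lemma derive2_soft_ramp_bound : exists2 M : R, 0 <= M & forall x, `|derive1n 2 soft_ramp x| <= M.
Proof.
have sc : continuous (derive1n 2 soft_ramp).
  by apply: smooth_expr_continuous; do 2 apply: smooth_expr_derive1; exact: soft_ramp_smooth.
have : bounded_set (derive1n 2 soft_ramp @` `[-1, 1]%classic).
  apply: compact_bounded; apply: continuous_compact; last exact: segment_compact.
  exact: continuous_subspaceT.
move=> [M [_ HM]]; exists (Num.max 0 M + 1).
  by rewrite addr_ge0// le_max lexx.
move=> x; have [x1|x1] := leP `|x| 1; last first.
  by rewrite derive2_soft_ramp_out// normr0 addr_ge0// le_max lexx.
apply: (HM (Num.max 0 M + 1)).
  by rewrite (@le_lt_trans _ _ (Num.max 0 M))// ?le_max ?lexx ?orbT// ltrDl.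
by exists x => //=; rewrite in_itv/= -ler_norml.
Qed.

(** A smoothing of the positive part of [y - p] on the scale [e]. Its second derivative is an
    approximate identity at [p]. *)
Definition ramp (p e y : R) : R := e * soft_ramp (e^-1 * y + - (e^-1 * p)).

Lemma ramp_smooth p e : smooth_expr (ramp p e).
Proof.
apply: smooth_mul; first exact: smooth_cst.
exact/smooth_aff/soft_ramp_smooth.
Qed.

Lemma derive1_ramp p e : e != 0 ->
  derive1 (ramp p e) = (fun y => derive1 soft_ramp (e^-1 * y + - (e^-1 * p))).
Proof.
move=> e0; rewrite /ramp derive1_scale; last exact/smooth_aff/soft_ramp_smooth.
rewrite derive1_aff; last exact: soft_ramp_smooth.
by apply/funext => y; rewrite mulrA divff// mul1r.
Qed.

Lemma derive2_ramp p e : e != 0 -> derive1n 2 (ramp p e) =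
  (fun y => e^-1 * derive1n 2 soft_ramp (e^-1 * y + - (e^-1 * p))).
Proof.
move=> e0; rewrite derive1nS derive1n1 derive1_ramp// derive1_aff//.
exact/smooth_expr_derive1/soft_ramp_smooth.
Qed.

Lemma derive2_ramp_out p e y : 0 < e -> e < `|y - p| -> derive1n 2 (ramp p e) y = 0.
Proof.
move=> e0 ey; rewrite derive2_ramp ?gt_eqF// derive2_soft_ramp_out ?mulr0//.
by rewrite -mulrBr normrM gtr0_norm ?invr_gt0// ltr_pdivlMl// mulr1.
Qed.

Lemma ramp_left p e y : 0 < e -> y <= p - e -> ramp p e y = 0.
Proof.
move=> e0 yp; rewrite /ramp soft_ramp_left ?mulr0//.
by rewrite -mulrBr ler_pdivrMl// mulrN1; lra.
Qed.

Lemma ramp_right p e y : 0 < e -> p + e <= y -> ramp p e y = y - p.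
Proof.
move=> e0 yp; rewrite /ramp soft_ramp_right -?mulrBr ?mulrA ?divff ?mul1r ?gt_eqF//.
by rewrite ler_pdivlMl// mulr1; lra.
Qed.

Lemma ramp_close p e y : 0 < e -> `|ramp p e y - Num.max (y - p) 0| <= e.
Proof.
move=> e0; rewrite /ramp -mulrBr.
have -> : Num.max (y - p) 0 = e * Num.max (e^-1 * (y - p)) 0.
  by rewrite maxr_pMr ?ltW// mulr0 mulrA divff ?mul1r// gt_eqF.
rewrite -mulrBr normrM gtr0_norm// -[leRHS]mulr1 ler_wpM2l ?soft_ramp_close ?ltW//.
Qed.

End SoftRamp.

(** * Second derivatives of ramps as approximate identities *)

Section Mollify.
Variable R : realType.
Implicit Types (f g eta : R -> R).
Local Notation leb := (@lebesgue_measure R).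
Local Notation I01 := (`[0%R, 1%R]%classic : set R).

Lemma leb_cc (a b : R) : a <= b -> leb `[a, b]%classic = (b - a)%:E.
Proof.
move=> ab; rewrite lebesgue_measure_itv/= lte_fin; case: (ltgtP a b) ab => [_|//|->] _.
  by rewrite EFinB.
by rewrite subrr.
Qed.

Lemma derive1_FTC f (a b : R) : a < b -> smooth_expr f ->
  \int[leb]_(x in `[a, b]) derive1 f x = f b - f a.
Proof.
move=> ab sf; rewrite /Rintegral (@continuous_FTC2 _ _ f)//.
- apply: continuous_subspaceT; apply: smooth_expr_continuous; exact: smooth_expr_derive1.
- split => [x _||].
  + by have [] := smooth_expr_is_derive x sf.
  + apply: cvg_at_right_filter; exact: smooth_expr_continuous.
  + apply: cvg_at_left_filter; exact: smooth_expr_continuous.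
Qed.

Lemma continuous01_integrable f : {within I01, continuous f} ->
  leb.-integrable I01 (EFin \o f).
Proof. by move=> cf; apply: continuous_compact_integrable => //; exact: segment_compact. Qed.

Lemma smooth01_integrable f : smooth_expr f -> leb.-integrable I01 (EFin \o f).
Proof.
by move=> sf; apply: continuous01_integrable; apply: continuous_subspaceT; exact:
  smooth_expr_continuous.
Qed.

Lemma ramp_smooth2 p e : smooth_expr (derive1n 2 (ramp p e : R -> R)).
Proof. by do 2 apply: smooth_expr_derive1; exact: ramp_smooth. Qed.

Lemma ramp_mass (p e : R) : 0 < e -> 0 < p - e -> p + e < 1 ->
  \int[leb]_(x in I01) derive1n 2 (ramp p e) x = 1.
Proof.
move=> e0 pe0 pe1; rewrite derive1nS derive1n1 derive1_FTC//; last first.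
  exact/smooth_expr_derive1/ramp_smooth.
rewrite derive1_ramp ?gt_eqF// -!mulrBr derive1_soft_ramp_right; last first.
  by rewrite ltr_pdivlMl//; lra.
rewrite derive1_soft_ramp_left ?subr0//.
by rewrite ltr_pdivrMl//; lra.
Qed.

Lemma within01_mul f g : {within I01, continuous f} -> {within I01, continuous g} ->
  {within I01, continuous (fun x => f x * g x)}.
Proof. by move=> cf cg x; apply: cvgM; [exact: cf|exact: cg]. Qed.

(** The total mass 1 does not give this bound: [soft_ramp] lies below [x] on ]0, 1[, so it is not
    convex and the second derivative changes sign. The bound is uniform in [e] because the height
    [M / e] is spread over a length [2 e]. *)
Lemma ramp_abs_mass : exists2 C : R, 0 <= C & forall p e : R, 0 < e -> 0 < p - e -> p + e < 1 ->
  \int[leb]_(x in I01) `|derive1n 2 (ramp p e) x| <= C.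
Proof.
have [M M0 HM] := derive2_soft_ramp_bound R.
exists (2 * M); first by rewrite mulr_ge0.
move=> p e e0 pe0 pe1.
have sub : `[p - e, p + e]%classic `<=` I01.
  by apply: subset_itv; rewrite bnd_simp; lra.
have -> : \int[leb]_(x in I01) `|derive1n 2 (ramp p e) x| =
          \int[leb]_(x in `[p - e, p + e]) `|derive1n 2 (ramp p e) x|.
  rewrite -(setIidr sub) Rintegral_mkcondr.
  apply: eq_Rintegral => x _; rewrite patchE; case: ifPn => // /negP xn.
  rewrite derive2_ramp_out ?normr0//.
  rewrite ltNge ler_norml; apply/negP => h; apply: xn; rewrite inE/= in_itv/=; lra.
have ci : leb.-integrable `[p - e, p + e] (EFin \o (fun x => `|derive1n 2 (ramp p e) x|)).
  apply: continuous_compact_integrable; first exact: segment_compact.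
  apply: continuous_subspaceT => x; apply: cvg_norm.
  by apply: smooth_expr_continuous; exact: ramp_smooth2.
apply: (@le_trans _ _ (\int[leb]_(x in `[p - e, p + e]) (e^-1 * M))).
  apply: le_Rintegral => //.
    apply: continuous_compact_integrable; first exact: segment_compact.
    by apply: continuous_subspaceT => x; exact: cvg_cst.
  move=> x _; rewrite derive2_ramp ?gt_eqF// normrM gtr0_norm ?invr_gt0//.
  by rewrite ler_wpM2l ?invr_ge0 ?(ltW e0).
rewrite Rintegral_cst//= leb_cc; last lra.
rewrite /= le_eqVlt; apply/orP; left; apply/eqP; field; lra.
Qed.

(** By [ramp_mass], [eta p] is itself an integral against the kernel. The difference [eta x - eta p]
    then matters only within [e] of [p], where continuity makes it small, and [ramp_abs_mass] bounds
    the rest. *)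
Lemma ramp_mollify eta (p : R) : {within I01, continuous eta} -> 0 < p < 1 ->
  forall d : R, 0 < d -> exists2 e0 : R, 0 < e0 & forall e : R, 0 < e < e0 ->
    `|\int[leb]_(x in I01) (eta x * derive1n 2 (ramp p e) x) - eta p| <= d.
Proof.
move=> ceta /andP[p0 p1] d d0.
have [C C0 HC] := ramp_abs_mass.
have [ceta' _ _] := (continuous_within_itvP eta (@ltr01 R)).1 ceta.
have /cvgrPdist_le/(_ (d / (C + 1))) := ceta' p (ltac:(by rewrite in_itv/= p0)).
have dC : 0 < d / (C + 1) by rewrite divr_gt0//; lra.
move=> /(_ dC)[/= r r0 Hr].
exists (Num.min r (Num.min p (1 - p))).
  by rewrite !lt_min r0 p0/=; lra.
move=> e; rewrite !lt_min => /andP[e0 /and3P[er ep e1p]].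
have pe0 : 0 < p - e by lra.
have pe1 : p + e < 1 by lra.
have csc : {within I01, continuous (derive1n 2 (ramp p e))}.
  by apply: continuous_subspaceT; apply: smooth_expr_continuous; exact: ramp_smooth2.
have i1 : leb.-integrable I01 (EFin \o (fun x => eta x * derive1n 2 (ramp p e) x)).
  exact/continuous01_integrable/within01_mul.
have i2 : leb.-integrable I01 (EFin \o (fun x => eta p * derive1n 2 (ramp p e) x)).
  apply/continuous01_integrable/within01_mul => //.
  by apply: continuous_subspaceT => x; exact: cvg_cst.
have -> : eta p = \int[leb]_(x in I01) (eta p * derive1n 2 (ramp p e) x).
  rewrite RintegralZl//; last by apply: smooth01_integrable; exact: ramp_smooth2.
  by rewrite ramp_mass// mulr1.
rewrite -RintegralB//.
apply: (le_trans (le_normr_Rintegral _ _)) => //.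
  apply: continuous01_integrable => x; apply: cvgB; first by apply: within01_mul.
  by apply: within01_mul => //; apply: continuous_subspaceT => y; exact: cvg_cst.
have i3 : leb.-integrable I01 (EFin \o (fun x => `|derive1n 2 (ramp p e) x|)).
  apply: continuous01_integrable; apply: continuous_subspaceT => x; apply: cvg_norm.
  by apply: smooth_expr_continuous; exact: ramp_smooth2.
apply: (@le_trans _ _ (\int[leb]_(x in I01) (d / (C + 1) * `|derive1n 2 (ramp p e) x|))).
  apply: le_Rintegral => //.
  - apply: continuous01_integrable => x; apply: cvg_norm; apply: cvgB.
      by apply: within01_mul.
    by apply: within01_mul => //; apply: continuous_subspaceT => y; exact: cvg_cst.
  - apply/continuous01_integrable/within01_mul.
      by apply: continuous_subspaceT => y; exact: cvg_cst.
    apply: continuous_subspaceT => x; apply: cvg_norm.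
    by apply: smooth_expr_continuous; exact: ramp_smooth2.
  - move=> x x01; rewrite -mulrBl normrM.
    have [xp|xp] := leP `|x - p| e.
      rewrite ler_wpM2r// distrC; apply: (Hr x).
      by rewrite /= distrC; exact: le_lt_trans er.
    by have /= -> := derive2_ramp_out e0 xp; rewrite normr0 !mulr0.
rewrite RintegralZl//.
apply: (@le_trans _ _ (d / (C + 1) * C)).
  by rewrite ler_wpM2l ?HC// ltW.
by rewrite mulrAC ler_pdivrMr; lra.
Qed.

End Mollify.

(** * Distributional second derivatives *)

Lemma integral_supp d (T : measurableType d) (R : realType) (mu : {measure set T -> \bar R})
    (D : set T) (f : T -> R) :
  (forall x, ~ D x -> f x = 0) -> (\int[mu]_x (f x)%:E = \int[mu]_(x in D) (f x)%:E)%E.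
Proof.
move=> fout; rewrite [RHS]integral_mkcond; apply: eq_integral => x _.
by rewrite patchE; case: ifPn => // /negP xD; rewrite fout// => Dx; apply: xD; rewrite inE.
Qed.

Section Tent.
Variable R : realType.
Implicit Types (f g eta : R -> R).
Local Notation leb := (@lebesgue_measure R).
Local Notation I01 := (`[0%R, 1%R]%classic : set R).

Lemma ramp_mollify_cvg eta (p : R) : {within I01, continuous eta} -> 0 < p < 1 ->
  (fun e : R => \int[leb]_(x in I01) (eta x * derive1n 2 (ramp p e) x)) @ 0^'+ --> eta p.
Proof.
move=> ceta p01; apply/cvgrPdist_le => d d0.
have [e0 e00 He] := ramp_mollify ceta p01 d0.
near=> e; rewrite distrC; apply: He; apply/andP; split; near: e.
  exact: nbhs_right_gt.
exact: nbhs_right_lt.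
Unshelve. all: by end_near. Qed.

Lemma smooth_expr_sum n (f : 'I_n -> R -> R) : (forall i, smooth_expr (f i)) ->
  smooth_expr (fun x => \sum_(i < n) f i x).
Proof.
elim: n f => [|n IH] f sf.
  by under [X in smooth_expr X]funext do rewrite big_ord0; exact: smooth_cst.
under [X in smooth_expr X]funext do rewrite big_ord_recr /=.
by apply: smooth_add => //; exact: IH.
Qed.

Lemma derive1_sum n (f : 'I_n -> R -> R) : (forall i, smooth_expr (f i)) ->
  derive1 (fun x => \sum_(i < n) f i x) = (fun x => \sum_(i < n) derive1 (f i) x).
Proof.
elim: n f => [|n IH] f sf.
  under [X in derive1 X]funext do rewrite big_ord0.
  by apply/funext => x; rewrite big_ord0 derive1E derive_cst.
under [X in derive1 X]funext do rewrite big_ord_recr /=.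
rewrite (derive1_add (f := fun x => \sum_(i < n) f (widen_ord (leqnSn n) i) x) (g :=
  f ord_max))//; last exact: smooth_expr_sum.
by apply/funext => x; rewrite big_ord_recr /= IH.
Qed.

Lemma cvgr_sum (T : Type) (F : set_system T) {FF : Filter F} n (f : 'I_n -> T -> R) (l : 'I_n ->
  R) :
  (forall i, f i @ F --> l i) -> (fun x => \sum_(i < n) f i x) @ F --> \sum_(i < n) l i.
Proof.
elim: n f l => [|n IH] f l fl.
  rewrite (_ : (fun x => _) = cst 0); last by apply/funext => x; rewrite big_ord0.
  by rewrite big_ord0; exact: cvg_cst.
rewrite (_ : (fun x => _) = fun x => \sum_(i < n) f (widen_ord (leqnSn n) i) x + f ord_max x);
  last first.
  by apply/funext => x; rewrite big_ord_recr.
by rewrite big_ord_recr /=; apply: cvgD; [exact: IH|exact: fl].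
Qed.

Lemma within01_sum n (f : 'I_n -> R -> R) : (forall i, {within I01, continuous (f i)}) ->
  {within I01, continuous (fun x => \sum_(i < n) f i x)}.
Proof. by move=> cf x; apply: cvgr_sum => i; exact: cf. Qed.

Lemma Rintegral01_sum n (f : 'I_n -> R -> R) : (forall i, {within I01, continuous (f i)}) ->
  \int[leb]_(x in I01) (\sum_(i < n) f i x) = \sum_(i < n) \int[leb]_(x in I01) f i x.
Proof.
elim: n f => [|n IH] f sf.
  under eq_Rintegral do rewrite big_ord0.
  by rewrite big_ord0 Rintegral_cst// mul0r.
under eq_Rintegral do rewrite big_ord_recr /=.
rewrite RintegralD//=; first by rewrite IH// big_ord_recr.
- by apply: continuous01_integrable; exact: within01_sum.
- exact: continuous01_integrable.
Qed.

(** To the left of all nodes every ramp is 0, and to the right ramp [i] equals [x - p i], so the sum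
    there is an affine function whose two coefficients are the moments. The margin [r] leaves room
    for the smoothing width. *)
Lemma sum_ramp_test n (w p : 'I_n -> R) (a c r e : R) : 0 < a -> c < 1 -> 0 < r ->
  a + r <= c ->
  (forall i, a + r <= p i <= c - r) -> \sum_i w i = 0 -> \sum_i w i * p i = 0 ->
  0 < e -> e <= r ->
  (forall x, x < a \/ c < x -> \sum_i w i * ramp (p i) e x = 0) /\
  test_fun (fun x => \sum_i w i * ramp (p i) e x).
Proof.
move=> a0 c1 r0 ac Hp w0 wp0 e0 er.
have out x : x < a \/ c < x -> \sum_i w i * ramp (p i) e x = 0.
  move=> [xa|cx].
    by rewrite big1// => i _; rewrite ramp_left ?mulr0//; move: (Hp i) => /andP[]; lra.
  transitivity (\sum_i (w i * x - w i * p i)).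
    apply: eq_bigr => i _; rewrite ramp_right ?mulrBr//; move: (Hp i) => /andP[]; lra.
  by rewrite sumrB -mulr_suml w0 wp0 mul0r subr0.
split => //; split; last first.
  by exists a, c; repeat split => //; lra.
apply: smooth_expr_derivable; apply: smooth_expr_sum => i.
by apply: smooth_mul; [exact: smooth_cst|exact: ramp_smooth].
Qed.

(* The two moment conditions make the combination vanish outside [a, c]. *)
Lemma tent_identity eta (mu : {measure set R -> \bar R}) n (w p : 'I_n -> R) (a c r : R) :
  {within I01, continuous eta} -> second_dist_deriv eta mu ->
  0 < a -> c < 1 -> 0 < r -> a + r <= c ->
  (forall i, a + r <= p i <= c - r) -> \sum_i w i = 0 -> \sum_i w i * p i = 0 ->
  (\int[mu]_y (\sum_i w i * Num.max (y - p i) 0)%:E = (\sum_i w i * eta (p i))%:E)%E.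
Proof.
move=> ceta [_ [mufin Hmu]] a0 c1 r0 ac Hp w0 wp0.
set T := fun y : R => \sum_i w i * Num.max (y - p i) 0.
pose J := `[a, c]%classic : set R.
have muJ : (mu J < +oo)%E by exact: mufin.
have mJ : measurable J by exact: measurable_itv.
have Tout x : x < a \/ c < x -> T x = 0.
  move=> [xa|cx].
    by rewrite /T big1// => i _; rewrite max_r ?mulr0//; move: (Hp i) => /andP[]; lra.
  transitivity (\sum_i (w i * x - w i * p i)).
    by apply: eq_bigr => i _; rewrite max_l ?mulrBr//; move: (Hp i) => /andP[]; lra.
  by rewrite sumrB -mulr_suml w0 wp0 mul0r subr0.
have restrict (f : R -> R) : (forall x, x < a \/ c < x -> f x = 0) ->
  (\int[mu]_y (f y)%:E = \int[mu]_(y in J) (f y)%:E)%E.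
  move=> f0; apply: integral_supp => x xJ; apply: f0.
  have [xa|ax] := ltP x a; first by left.
  by right; rewrite ltNge; apply/negP => xc; apply: xJ; rewrite /J/= in_itv/= ax.
have cint (f : R -> R) : continuous f -> mu.-integrable J (EFin \o f).
  move=> cf; apply: measurable_bounded_integrable => //.
    by apply: measurable_funTS; exact: continuous_measurable_fun.
  have : bounded_set (f @` J).
    apply: compact_bounded; apply: continuous_compact; last exact: segment_compact.
    exact: continuous_subspaceT.
  by move=> [M [Mr HM]]; exists M; split => // N MN x Jx; apply: (HM N MN); exists x.
have cT : continuous T.
  move=> x; apply: cvgr_sum => i; apply: cvgMl_tmp.
  by apply: (@continuous_max R R^o (fun y => y - p i) (fun=> 0) x); [apply: cvgB => //; exact:
    cvg_cst|exact: cvg_cst].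
pose phi e := fun x => \sum_i w i * ramp (p i) e x.
have cphi e : continuous (phi e).
  apply: smooth_expr_continuous; apply: smooth_expr_sum => i.
  by apply: smooth_mul; [exact: smooth_cst|exact: ramp_smooth].
(* The quantity [B e] has two limits as [e] tends to 0. Since [phi e] is uniformly close to [T] and
   [mu J] is finite, it tends to the integral of [T]; by the definition of the distributional
   derivative it is also a combination of integrals of [eta] against approximate identities, which
   tends to the sum of the [w i * eta (p i)]. *)
pose B e := \int[mu]_(y in J) phi e y.
pose L := \int[mu]_(y in J) T y.
suff LE : L = \sum_i w i * eta (p i).
  rewrite (restrict T)// -LE /L /Rintegral fineK//.
  by apply: integrable_fin_num => //; exact: cint.
have BL : B @ 0^'+ --> L.
  apply/cvgrPdist_le => d d0.
  set W := (\sum_i `|w i|) * fine (mu J).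
  have W0 : 0 <= W by rewrite mulr_ge0 ?fine_ge0// sumr_ge0.
  near=> e.
  have e0 : 0 < e by near: e; exact: nbhs_right_gt.
  have ed : e <= d / (W + 1).
    by near: e; apply: nbhs_right_le; rewrite divr_gt0//; lra.
  rewrite /L /B -RintegralB//; [|exact: cint..].
  apply: (le_trans (le_normr_Rintegral _ _)) => //.
    by apply: (cint (fun x => T x - phi e x)) => x; apply: cvgB; [exact: cT|exact: cphi].
  apply: (@le_trans _ _ (\int[mu]_(y in J) (e * \sum_i `|w i|))).
    apply: le_Rintegral => //.
    - by apply: (cint (fun x => `|T x - phi e x|)) => x; apply: cvg_norm; apply: cvgB; [exact:
      cT|exact: cphi].
    - by apply: (cint (fun x => e * \sum_i `|w i|)) => x; exact: cvg_cst.
    - move=> x _; rewrite /T /phi -sumrB mulr_sumr.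
      apply: (le_trans (ler_norm_sum _ _ _)); apply: ler_sum => i _.
      by rewrite -mulrBr normrM mulrC ler_wpM2r// distrC ramp_close.
  rewrite Rintegral_cst// -mulrA -/W.
  apply: (@le_trans _ _ (e * (W + 1))); first by rewrite ler_wpM2l ?(ltW e0)//; lra.
  by rewrite -ler_pdivlMr//; lra.
have pin i : 0 < p i < 1 by move: (Hp i) => /andP[]; lra.
have AL : (fun e => \sum_i w i * \int[leb]_(x in I01) (eta x * derive1n 2 (ramp
  (p i) e) x)) @ 0^'+ -->
   \sum_i w i * eta (p i).
  apply: cvgr_sum => i; apply: cvgMl_tmp; exact: ramp_mollify_cvg.
have AB : \forall e \near 0^'+, \sum_i w i * \int[leb]_(x in I01) (eta x * derive1n 2 (ramp
  (p i) e) x) = B e.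
  near=> e.
  have e0 : 0 < e by near: e; exact: nbhs_right_gt.
  have er : e <= r by near: e; exact: nbhs_right_le.
  have [phiout tphi] := sum_ramp_test a0 c1 r0 ac Hp w0 wp0 e0 er.
  have := Hmu _ tphi; rewrite (restrict _ phiout) => /(congr1 fine).
  rewrite -[RHS]/(B e) => <-.
  rewrite -[RHS]/(\int[leb]_(x in I01) (eta x * derive1n 2 (phi e) x)).
  have cr i : {within I01, continuous (fun x => eta x * derive1n 2 (ramp (p i) e) x)}.
    apply: within01_mul => //; apply: continuous_subspaceT; apply: smooth_expr_continuous.
    exact: ramp_smooth2.
  transitivity (\int[leb]_(x in I01) (\sum_i w i * (eta x * derive1n 2 (ramp (p i) e) x))).
    rewrite Rintegral01_sum; last first.
      move=> i; apply: within01_mul => //; apply: continuous_subspaceT => x; exact: cvg_cst.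
    by apply: eq_bigr => i _; rewrite RintegralZl//; exact: continuous01_integrable.
  apply: eq_Rintegral => x _.
  have -> : derive1n 2 (phi e) x = \sum_i w i * derive1n 2 (ramp (p i) e) x.
    rewrite derive1nS derive1n1 /phi.
    have s1 i : smooth_expr (ramp (p i) e) by exact: ramp_smooth.
    rewrite derive1_sum; last by move=> i; apply: smooth_mul => //; exact: smooth_cst.
    rewrite (_ : (fun x => _) = fun x => \sum_i w i * derive1 (ramp (p i) e) x); last first.
      by apply/funext => y; apply: eq_bigr => i _; rewrite derive1_scale.
    have s2 i : smooth_expr (derive1 (ramp (p i) e)) by exact: smooth_expr_derive1.
    rewrite derive1_sum; last by move=> i; apply: smooth_mul => //; exact: smooth_cst.
    by apply: eq_bigr => i _; rewrite derive1_scale.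
  by rewrite mulr_sumr; apply: eq_bigr => i _; rewrite mulrCA.
have BL' : B @ 0^'+ --> \sum_i w i * eta (p i).
  by apply: cvg_trans AL; exact: near_eq_cvg.
by rewrite -(cvg_lim (@Rhausdorff R) BL) (cvg_lim (@Rhausdorff R) BL').
Unshelve. all: by end_near. Qed.

End Tent.

(** * Green representation of a function through its second derivative *)

Section Representation.
Variable R : realType.
Implicit Types (eta : R -> R) (x y t : R).
Local Notation I01 := (`[0%R, 1%R]%classic : set R).

(* Green function of -d^2/dx^2 on [0, 1] with conditions u'(0) = 0 and u(1) = 0 *)
Definition green x y : R := 1 - Num.max x y.

(** Kinks of a trapezoid: 0 up to [x t / 2], rising to [(1 - x) (1 - t)] at [x t], flat up to [x],
    falling with slope -1 to 0 at [1 - (1 - x) t]. The weights are the jumps of slope, with [s] the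
    slope of the rising edge. As [t] decreases to 0 the trapezoid fills out [green x]. *)
Let node x t (i : 'I_4) : R := nth 0 [:: x * t / 2; x * t; x; 1 - (1 - x) * t] i.
Let weight x t (i : 'I_4) : R :=
  let s := (1 - x) * (1 - t) / (x * t / 2) in nth 0 [:: s; - s; -1; 1] i.

Let tent x t y : R := \sum_(i < 4) weight x t i * Num.max (y - node x t i) 0.

Let tentE x t y : 0 < x < 1 -> 0 < t <= 1 / 2 ->
  tent x t y = if y <= x then (1 - x) * (1 - t) * Num.max 0 (Num.min 1 ((y - x * t / 2) /
    (x * t / 2)))
               else Num.max 0 (1 - (1 - x) * t - y).
Proof.
move=> /andP[x0 x1] /andP[t0 t1]; rewrite /tent !big_ord_recl big_ord0 /weight /node /=.
set u := x * t / 2.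
have u0 : 0 < u by rewrite divr_gt0// mulr_gt0.
have -> : x * t = 2 * u by rewrite /u; field.
have ux : 2 * u < x by rewrite /u; nra.
have xc : x < 1 - (1 - x) * t by nra.
set H := (1 - x) * (1 - t); set c := 1 - (1 - x) * t.
have Hc : H = c - x by rewrite /H /c; ring.
have scale z : Num.max (u * z) 0 = u * Num.max z 0 by rewrite maxr_pMr ?ltW// mulr0.
(* In the unit [u] the two left nodes sit at 1 and 2, which frees the case analysis from
   products. *)
pose q := y / u; have yq : y = u * q by rewrite /q; field; rewrite gt_eqF.
have -> : (y - u) / u = q - 1 by rewrite /q; field; rewrite gt_eqF.
have -> : y - u = u * (q - 1) by rewrite yq; ring.
have -> : y - 2 * u = u * (q - 2) by rewrite yq; ring.
rewrite !scale.
have -> A B D : H / u * (u * A) + (- (H / u) * (u * B) + D) = H * (A - B) + D.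
  by field; rewrite gt_eqF.
have -> : Num.max (q - 1) 0 - Num.max (q - 2) 0 = Num.max 0 (Num.min 1 (q - 1)).
  have [q1|q1] := leP q 1.
    have h1 : q - 1 <= 0 by lra.
    have h2 : q - 2 <= 0 by lra.
    have h3 : q - 1 <= 1 by lra.
    by rewrite (max_r h1) (max_r h2) (min_r h3) (max_l h1) subrr.
  have h1 : 0 <= q - 1 by lra.
  have [q2|q2] := leP q 2.
    have h2 : q - 2 <= 0 by lra.
    have h3 : q - 1 <= 1 by lra.
    by rewrite (max_l h1) (max_r h2) (min_r h3) (max_r h1) subr0.
  have h2 : 0 <= q - 2 by lra.
  have h3 : 1 <= q - 1 by lra.
  by rewrite (max_l h1) (max_l h2) (min_l h3) (max_r ler01); lra.
have [yx|xy] := leP y x.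
  rewrite (max_r (x := y - x)); last lra.
  rewrite (max_r (x := y - c)); last (rewrite /c; lra).
  by ring.
have q2 : 2 <= q by rewrite /q ler_pdivlMr//; lra.
have h1 : 1 <= q - 1 by lra.
have h2 : 0 <= y - x by lra.
rewrite (min_l h1) (max_r ler01) (max_l h2).
have [yc|cy] := leP y c.
  have h3 : y - c <= 0 by lra.
  have h4 : 0 <= c - y by lra.
  rewrite (max_r h3) (max_r h4); lra.
have h3 : 0 <= y - c by lra.
have h4 : c - y <= 0 by lra.
rewrite (max_l h3) (max_l h4); lra.
Qed.

(** The exponent [n.+1] keeps the parameter at most 1/2, as [tentE] requires from [n = 0] on. *)
Let half n : R := (1 / 2) ^+ n.+1.

Let half_gt0 n : 0 < half n. Proof. by rewrite exprn_gt0//; lra. Qed.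

Let half_le n : half n <= 1 / 2.
Proof. by rewrite /half exprS ger_pMr ?exprn_ile1//; lra. Qed.

Let half_cvg : half @ \oo --> (0 : R).
Proof.
have -> : half = geometric (1 / 2) (1 / 2).
  by apply/funext => n; rewrite /half exprS.
by apply: cvg_geometric; rewrite ger0_norm; lra.
Qed.

Let tent_ge0 x y n : 0 < x < 1 -> 0 <= tent x (half n) y.
Proof.
move=> x01; rewrite tentE ?half_gt0 ?half_le//; move: x01 => /andP[x0 x1].
have := half_le n; have := half_gt0 n => t0 t1.
case: ifP => _; last by rewrite le_max lexx.
by apply: mulr_ge0; [nra|rewrite le_max lexx].
Qed.

(** Halving [t] moves the rising edge to the left, lifts the plateau and moves the right foot to the
    right. *)
Let tent_nd x y : 0 < x < 1 -> {homo (fun n => tent x (half n) y) : m n / (m <= n)%N >-> m <= n}.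
Proof.
move=> x01; apply/nondecreasing_seqP => n.
rewrite !tentE ?half_gt0 ?half_le//; move: x01 => /andP[x0 x1].
have -> : half n.+1 = half n / 2 by rewrite /half [RHS]mulrC exprS; congr (_ * _); field.
have := half_le n; have := half_gt0 n; move: (half n) => t t0 t1.
case: ifP => _; last first.
  by rewrite ge_max !le_max lexx /=; apply/orP; right; nra.
have u0 : 0 < x * t / 2 by rewrite divr_gt0// mulr_gt0.
have [yu|uy] := leP y (x * t / 2).
  rewrite [X in _ * X <= _](_ : _ = 0) ?mulr0.
    by apply: mulr_ge0; [nra|rewrite le_max lexx].
  by apply/max_idPl; rewrite ge_min; apply/orP; right; rewrite pmulr_lle0 ?invr_gt0//; lra.
apply: ler_pM; [nra|by rewrite le_max lexx|nra|].
rewrite ge_max !le_max lexx/=; apply/orP; right.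
rewrite le_min; apply/andP; split; first by rewrite ge_min lexx.
rewrite ge_min; apply/orP; left; rewrite ler_pdivlMr; nra.
Qed.

Let tent_cvg x y : 0 < x < 1 -> 0 < y < 1 -> (fun n => tent x (half n) y) @ \oo --> green x y.
Proof.
move=> x01 /andP[y0 y1]; apply/cvgrPdist_le => e e0.
have /cvgr0_norm_le/(_ (Num.min e y)) := half_cvg.
rewrite lt_min e0 y0 => /(_ isT); apply: filterS => n.
rewrite tentE ?half_gt0 ?half_le//; have := half_le n; have := half_gt0 n; move:
  (half n) => t t0 t1.
move: x01 => /andP[x0 x1]; rewrite (ger0_norm (ltW t0)) => tm.
have te : t <= e by move: tm; rewrite le_min => /andP[].
have ty : t <= y by move: tm; rewrite le_min => /andP[].
rewrite /green; have [yx|xy] := leP y x.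
  have u0 : 0 < x * t / 2 by rewrite divr_gt0// mulr_gt0.
  have xty : x * t <= y by nra.
  have h1 : 1 <= (y - x * t / 2) / (x * t / 2) by rewrite ler_pdivlMr; lra.
  rewrite (min_l h1) (max_r ler01) mulr1 ger0_norm; nra.
have [h|h] := leP 0 (1 - (1 - x) * t - y); rewrite ger0_norm; nra.
Qed.

(* Monotone convergence along the tents, which are compactly supported in ]0, 1[ and
   increase to [green x]. *)
Lemma green_representation eta (mu : {measure set R -> \bar R}) (d x : R) :
  {within I01, continuous eta} -> second_dist_deriv eta mu ->
  (fun t => (eta t - eta 0) / t) @ 0^'+ --> d -> 0 < x < 1 ->
  (\int[mu]_(y in `]0%R, 1%R[) (green x y)%:E = (eta 1 - d * (1 - x) - eta x)%:E)%E.
Proof.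
move=> ceta dmu etad x01; move: (x01) => /andP[x0 x1].
have mD : measurable (`]0, 1[%classic : set R) by exact: measurable_itv.
have cT n : continuous (tent x (half n)).
  move=> y; apply: cvgr_sum => i; apply: cvgMl_tmp.
  by apply: (@continuous_max R R^o (fun y => y - node x (half n) i) (fun=> 0) y); [apply:
    cvgB => //; exact: cvg_cst|exact: cvg_cst].
have mT n : measurable_fun (`]0%R, 1%R[%classic : set R) (EFin \o tent x (half n)).
  by apply/measurable_EFinP; apply: measurable_funTS; exact: continuous_measurable_fun.
have C1 : (\int[mu]_(y in `]0%R, 1%R[) (tent x (half n) y)%:E)%E @[n --> \oo] -->
    (\int[mu]_(y in `]0%R, 1%R[) (green x y)%:E)%E.
  have -> : (\int[mu]_(y in `]0%R, 1%R[) (green x y)%:E =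
     \int[mu]_(y in `]0%R, 1%R[) (limn (fun n => (tent x (half n) y)%:E)))%E.
    apply: eq_integral => y; rewrite inE/= in_itv/= => y01.
    apply/esym/cvg_lim => //; apply: cvg_EFin; first exact: nearW.
    exact: tent_cvg.
  apply: cvg_monotone_convergence => //.
  - by move=> n y _; rewrite lee_fin; exact: tent_ge0.
  - by move=> y _ m n mn; rewrite lee_fin; exact: tent_nd.
pose A n := \sum_(i < 4) weight x (half n) i * eta (node x (half n) i).
have TA n : (\int[mu]_(y in `]0%R, 1%R[) (tent x (half n) y)%:E = (A n)%:E)%E.
  have := half_le n; have := half_gt0 n; rewrite /A; move: (half n) => t t0 t1.
  have t01 : 0 < t <= 1 / 2 by rewrite t0.
  have u0 : 0 < x * t / 2 by rewrite divr_gt0// mulr_gt0.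
  have -> : (\int[mu]_(y in `]0%R, 1%R[) (tent x t y)%:E = \int[mu]_y (tent x t y)%:E)%E.
    rewrite [LHS]integral_mkcond; apply: eq_integral => y _.
    rewrite patchE; case: ifPn => // /negP y01.
    rewrite tentE//; have [yx|xy] := leP y x.
      have y0 : y <= 0.
        by rewrite leNgt; apply/negP => y0; apply: y01; rewrite inE/= in_itv/= y0; lra.
      rewrite (max_l (x := 0)) ?mulr0// ge_min; apply/orP; right.
      by rewrite pmulr_lle0 ?invr_gt0//; lra.
    have y1 : 1 <= y.
      by rewrite leNgt; apply/negP => y1; apply: y01; rewrite inE/= in_itv/= y1; lra.
    by rewrite (max_l (x := 0))//; nra.
  (* The support is enlarged to run from [x t / 4] to [1 - (1 - x) t / 2]; [r] is the distance this
     leaves to the extreme nodes. *)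
  pose r := Num.min (x * t / 4) ((1 - x) * t / 2).
  have r1 : r <= x * t / 4 by rewrite ge_min lexx.
  have r2 : r <= (1 - x) * t / 2 by rewrite ge_min lexx orbT.
  have h1 : 0 < x * t by rewrite mulr_gt0.
  have h2 : 0 < (1 - x) * t by rewrite mulr_gt0//; lra.
  have h3 : x * t <= x / 2 by nra.
  have h4 : (1 - x) * t <= (1 - x) / 2 by nra.
  apply: (@tent_identity _ eta mu 4 (weight x t) (node x t) (x * t / 4) (1 -
    (1 - x) * t / 2) r) => //.
  - lra.
  - lra.
  - by rewrite lt_min; apply/andP; split; lra.
  - lra.
  - by move=> [[|[|[|[|//]]]] /= ?]; rewrite /node /=; apply/andP; split; lra.
  - by rewrite !big_ord_recl big_ord0 /weight /=; lra.
  - rewrite !big_ord_recl big_ord0 /weight /node /=; field.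
    by rewrite !gt_eqF.
have CA : A @ \oo --> eta 1 - d * (1 - x) - eta x.
  pose q t := (eta t - eta 0) / t.
  have qP (s : R) : 0 < s -> (fun n => q (s * half n)) @ \oo --> d.
    move=> s0; apply: (proj1 (cvg_at_rightP q 0 d) etad (fun n => s * half n)); split.
      by move=> n; rewrite mulr_gt0.
    by rewrite -[X in _ --> X](mulr0 s); exact: cvgn_Ml.
  have eta1 : (fun n => eta (1 - (1 - x) * half n)) @ \oo --> eta 1.
    have [_ _ E1] := (continuous_within_itvP eta (@ltr01 R)).1 ceta.
    apply: (proj1 (cvg_at_leftP eta 1 (eta 1)) E1 (fun n => 1 - (1 - x) * half n)); split.
      by move=> n; rewrite ltrBlDr ltrDl mulr_gt0//; lra.
    rewrite -[X in _ --> X]subr0; apply: cvgn_B; first exact: cvgn_cst.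
    by rewrite -[X in _ --> X](mulr0 (1 - x)); exact: cvgn_Ml.
  (* The two left nodes carry opposite weights, so [eta 0] can be inserted: divided by [x t / 2],
     their contribution becomes [q (x t / 2) - 2 q (x t)], whose limit is [- d]. *)
  have -> : A = (fun n => (eta (1 - (1 - x) * half n) - (1 - x) * ((1 - half n) * (2 * q
    (x * half n) - q (x / 2 * half n)))) - eta x).
    apply/funext => n; rewrite /A !big_ord_recl big_ord0 /weight /node /q /=.
    have := half_gt0 n; move: (half n) => t t0.
    have -> : x / 2 * t = x * t / 2 by ring.
    by field; rewrite !gt_eqF.
  apply: cvgn_B; last exact: cvgn_cst.
  apply: cvgn_B => //.
  rewrite [d * _]mulrC; apply: cvgn_Ml.
  have -> : d = (1 - 0) * (2 * d - d) by ring.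
  apply: cvgM.
    by apply: cvgn_B => //; exact: cvgn_cst.
  apply: cvgn_B; first by apply: cvgn_Ml; exact: qP.
  by apply: qP; lra.
have C2 : (fun n => (A n)%:E) @ \oo --> (eta 1 - d * (1 - x) - eta x)%:E.
  by apply: cvg_EFin; first exact: nearW.
move: C1; under eq_cvg do rewrite TA.
by move=> C1; rewrite -(cvg_lim _ C1)// -(cvg_lim _ C2).
Qed.

End Representation.

(** * Densities and measures *)

Section Density.
Context d (T : measurableType d) (R : realType) (mu : {measure set T -> \bar R}).
Variables (g : T -> R).
Hypotheses (g0 : forall x, 0 <= g x) (mg : measurable_fun setT g).

(** The two proofs are arguments so that a canonical measure structure can be declared on this
    constant. *)
Definition density_measure of (forall x, 0 <= g x) & measurable_fun setT g :=
  fun A : set T => (\int[mu]_(x in A) (g x)%:E)%E.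

Local Notation dens := (density_measure g0 mg).

Let dens0 : dens set0 = 0%E. Proof. by rewrite /dens integral_set0. Qed.

Let dens_ge0 A : (0 <= dens A)%E.
Proof. by apply: integral_ge0 => x _; rewrite lee_fin. Qed.

Let dens_sigma_additive : semi_sigma_additive dens.
Proof.
move=> F mF tF mUF; rewrite /dens ge0_integral_bigcup//; last 2 first.
- by apply/measurable_EFinP; exact: measurable_funTS.
- by move=> x _; rewrite lee_fin.
apply: is_cvg_ereal_nneg_natsum => n _; exact: dens_ge0.
Qed.

HB.instance Definition _ := isMeasure.Build d T R dens dens0 dens_ge0 dens_sigma_additive.

Import HBNNSimple.

(** Both sides are monotone limits along simple functions approximating [f]; on indicators the
    identity is the definition of the density measure. *)
Lemma ge0_integral_density (f : T -> R) (E : set T) : (forall x, 0 <= f x) ->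
  measurable E -> measurable_fun setT f ->
  (\int[dens]_(x in E) (f x)%:E = \int[mu]_(x in E) (f x * g x)%:E)%E.
Proof.
move=> f0 mE mf.
have mfE : measurable_fun E (EFin \o f) by apply/measurable_EFinP; exact: measurable_funTS.
have mgE : measurable_fun E (EFin \o g) by apply/measurable_EFinP; exact: measurable_funTS.
pose h := nnsfun_approx mE mfE.
have hcvg x : E x -> (EFin \o h n) x @[n --> \oo] --> (f x)%:E.
  by move=> Ex; apply: cvg_nnsfun_approx => // y _; rewrite lee_fin.
have -> : (\int[dens]_(x in E) (f x)%:E = lim (\int[dens]_(x in E) (EFin \o h n) x @[n --> \oo]))%E.
  rewrite -monotone_convergence//.
  - by apply: eq_integral => x /[!inE] Ex; apply/esym/cvg_lim => //; exact: hcvg.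
  - move=> n; apply/measurable_EFinP.
    by apply: (measurable_funS measurableT) => //; exact/measurable_funP.
  - by move=> n x Ex //=; rewrite lee_fin.
  - by move=> x Ex a b ab; rewrite lee_fin; exact/lefP/nd_nnsfun_approx.
have -> : (\int[mu]_(x in E) (f x * g x)%:E =
   lim (\int[mu]_(x in E) (h n x * g x)%:E @[n --> \oo]))%E.
  rewrite -monotone_convergence//.
  - apply: eq_integral => x /[!inE] Ex; apply/esym/cvg_lim => //.
    under eq_fun do rewrite EFinM; rewrite EFinM.
    by apply: cvgeZr => //; exact: hcvg.
  - move=> n; apply/measurable_EFinP; apply: measurable_funM; last exact: measurable_funTS.
    by apply: (measurable_funS measurableT) => //; exact/measurable_funP.
  - by move=> n x Ex //=; rewrite lee_fin mulr_ge0.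
  - by move=> x Ex a b ab; rewrite lee_fin ler_wpM2r//; exact/lefP/nd_nnsfun_approx.
congr (lim _); congr (_ @ \oo); apply/funext => n.
transitivity (\int[dens]_(x in E)
   (\sum_(y \in range (h n)) (y * \1_(h n @^-1` [set y]) x)%:E))%E.
  by apply: eq_integral => t tE; rewrite /= fimfunE -fsumEFin.
have indich m r : measurable_fun E (fun x => (r * \1_(h m @^-1` [set r]) x)%:E).
  by apply: (measurable_comp measurableT) => //; exact: measurable_funM.
rewrite ge0_integral_fsum//; last by move=> m y Ey; exact: nnfun_muleindic_ge0.
transitivity (\int[mu]_(x in E) (\sum_(y \in range (h n))
    (y * \1_(h n @^-1` [set y]) x)%:E * (g x)%:E))%E; last first.
  apply: eq_integral => x xE.
  rewrite -ge0_mule_fsuml => [|y]; last exact: nnfun_muleindic_ge0.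
  by rewrite fsumEFin // -(fimfunE _ x) EFinM.
rewrite ge0_integral_fsum//; last 2 first.
  - by move=> y; apply: emeasurable_funM.
  - by move=> m y Ey; apply: mule_ge0; [exact: nnfun_muleindic_ge0|rewrite lee_fin].
apply: eq_fsbigr => r rhn.
under eq_integral do rewrite EFinM.
rewrite integralZl_indic_nnsfun//.
under [RHS]eq_integral do rewrite EFinM -muleA.
rewrite ge0_integralZl//.
- under [X in _ = (_ * X)%E]eq_integral do rewrite muleC.
  rewrite [X in _ = (_ * X)%E](eq_integral ((EFin \o g) \_ (h n @^-1` [set r]))); last first.
    by move=> x xE; rewrite epatch_indic.
  rewrite -integral_mkcondr integral_indic//; congr (_ * _)%E.
  by rewrite setIC.
- by apply: emeasurable_funM => //; apply/measurable_EFinP.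
- by move=> t Et; rewrite mule_ge0 ?lee_fin.
- by move: rhn; rewrite inE => -[t _ <-]; rewrite lee_fin.
Qed.

End Density.

Lemma ge0_integral_density_add d (T : measurableType d) (R : realType)
    (m mu nu : {measure set T -> \bar R}) (g f : T -> R) (E : set T) :
  (forall x, 0 <= g x) -> measurable_fun setT g ->
  (forall A, measurable A -> m A = (\int[mu]_(x in A) (g x)%:E + nu A)%E) ->
  (forall x, 0 <= f x) -> measurable_fun setT f -> measurable E ->
  (\int[m]_(x in E) (f x)%:E =
   \int[mu]_(x in E) (f x * g x)%:E + \int[nu]_(x in E) (f x)%:E)%E.
Proof.
move=> g0 mg mE f0 mf mEE.
rewrite -(ge0_integral_density mu g0 mg)// -ge0_integral_measure_add//.
- by apply: eq_measure_integral => A mA _; rewrite mE//; exact/esym/measure_addE.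
- by move=> x _; rewrite lee_fin.
- by apply/measurable_EFinP; exact: measurable_funTS.
Qed.

Section LebesgueR.
Variable R : realType.

Lemma measurable_id_lebesgue : measurable_fun setT (fun x : measurableTypeR R => (x : R)).
Proof. by move=> _ A mA; rewrite setTI. Qed.

(* Lebesgue measure lives on [measurableTypeR R], whose display differs from the one
   of the measures in [second_dist_deriv]. *)
Definition lebR : {measure set R -> \bar R} :=
  measure_function_pushforward__canonical__measure_function_Measure
    (@lebesgue_measure R) measurable_id_lebesgue.

Lemma ge0_integral_lebR (D : set R) (f : R -> \bar R) :
  measurable D -> measurable_fun D f -> (forall y, D y -> (0 <= f y)%E) ->
  (\int[lebR]_(y in D) f y = \int[lebesgue_measure]_(y in D) f y)%E.
Proof.
move=> mD mf f0; rewrite /lebR ge0_integral_pushforward//.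
by move=> y /set_mem; exact: f0.
Qed.

End LebesgueR.

(** * A measure on ]0, 1[ is determined by its Green integrals *)

Section Determination.
Variable R : realType.
Implicit Types (x y : R) (mu : {measure set R -> \bar R}).
Local Notation D01 := (`]0%R, 1%R[%classic : set R).

Lemma green_ge0 x y : x <= 1 -> y <= 1 -> 0 <= green x y.
Proof. by move=> x1 y1; rewrite /green subr_ge0 ge_max x1. Qed.

Lemma green_le x y : green x y <= 1 - x.
Proof. by rewrite /green lerD2l lerN2 le_max lexx. Qed.

Lemma greenC x y : green x y = green y x.
Proof. by rewrite /green maxC. Qed.

Lemma green_nincr x x' y : x <= x' -> green x' y <= green x y.
Proof. by move=> xx'; rewrite /green lerD2l lerN2 ge_max !le_max xx' lexx orbT. Qed.

Lemma green_lipschitz x x' y : x <= x' -> green x y - green x' y <= x' - x.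
Proof.
move=> xx'; rewrite /green.
have [|] := leP x y; have [|] := leP x' y; lra.
Qed.

Lemma measurable_green x : measurable_fun setT (green x).
Proof. by apply: measurable_funB => //; exact: measurable_maxr. Qed.

(* The slopes of [green] on [z, x] increase to the indicator function of ]0, x[ as z
   increases to x. *)
Lemma green_determines_itv mu1 mu2 x : 0 < x < 1 ->
  (forall z, 0 < z < 1 -> (\int[mu1]_(y in D01) (green z y)%:E =
    \int[mu2]_(y in D01) (green z y)%:E)%E) ->
  (forall z, 0 < z < 1 -> (\int[mu1]_(y in D01) (green z y)%:E < +oo)%E) ->
  mu1 `]0, x[%classic = mu2 `]0, x[%classic.
Proof.
move=> x01 H12 Hfin; move: (x01) => /andP[x0 x1].
pose z n := x - x * (1 / 2) ^+ n.+1.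
(* It is 1 up to [z n], falls linearly to 0 at [x], and is 0 beyond. *)
pose s n y := (green (z n) y - green x y) / (x - z n).
have e0 n : 0 < (1 / 2) ^+ n.+1 :> R by rewrite exprn_gt0.
have e1 n : (1 / 2) ^+ n.+1 < 1 :> R by rewrite exprn_ilt1//; lra.
have zx n : z n < x by rewrite /z; have := e0 n; nra.
have z0 n : 0 < z n by rewrite /z; have := e1 n; nra.
have mg t : measurable_fun D01 (EFin \o green t).
  by apply/measurable_EFinP; apply: measurable_funTS; exact: measurable_green.
have ms n : measurable_fun D01 (EFin \o s n).
  apply/measurable_EFinP; apply: measurable_funTS; apply: measurable_funM => //.
  by apply: measurable_funB; exact: measurable_green.
have s0 n y : 0 <= s n y.
  by rewrite /s divr_ge0// subr_ge0 ?green_nincr// ltW.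
have s1 n y : y <= z n -> s n y = 1.
  move=> yz; rewrite /s /green (max_l yz) max_l; last exact: le_trans yz (ltW (zx n)).
  by field; rewrite subr_eq0 gt_eqF.
have s2 n y : z n <= y -> y <= x -> s n y = (x - y) / (x - z n).
  by move=> zy yx; rewrite /s /green (max_r zy) (max_l yx); congr (_ / _); ring.
have s3 n y : x <= y -> s n y = 0.
  move=> xy; rewrite /s /green (max_r xy) max_r; last exact: le_trans (ltW (zx n)) xy.
  by rewrite subrr mul0r.
have zcvg : z @ \oo --> x.
  rewrite -[X in _ --> X]subr0; apply: cvgn_B; first exact: cvgn_cst.
  rewrite -[X in _ --> X](mulr0 x); apply: cvgn_Ml.
  rewrite (_ : (fun n => _) = geometric (1 / 2) (1 / 2)); last by apply/funext => n; rewrite exprS.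
  by apply: cvg_geometric; rewrite ger0_norm; lra.
have C (mu : {measure set R -> \bar R}) :
   (\int[mu]_(y in D01) (s n y)%:E)%E @[n --> \oo] --> mu `]0, x[%classic.
  have -> : mu `]0, x[%classic = (\int[mu]_(y in D01) (limn (fun n => (s n y)%:E)))%E.
    rewrite -(setIidl (_ : `]0, x[%classic `<=` D01)); last first.
      by apply: subset_itvl; rewrite bnd_simp ltW.
    rewrite -integral_indic//; apply: eq_integral => y; rewrite inE/= in_itv/= => /andP[y0 y1].
    apply/esym/cvg_lim => //; apply: cvg_EFin; first exact: nearW.
    rewrite indicE; have [xy|yx] := leP x y.
      rewrite memNset/=; last by rewrite in_itv/= y0 ltNge xy.
      by rewrite (_ : fine \o _ = cst 0); [exact: cvg_cst|apply/funext => n /=; rewrite s3].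
    rewrite mem_set/=; last by rewrite in_itv/= y0.
    apply: (@cvg_trans _ (cst (1:R) @ \oo)); last exact: cvg_cst.
    have yz : \forall n \near \oo, y <= z n by exact: (cvgr_ge x).
    apply: near_eq_cvg; apply: filterS yz => n yz /=.
    by rewrite s1.
  apply: cvg_monotone_convergence => //.
  - by move=> n y _; rewrite lee_fin.
  - move=> y _; apply/nondecreasing_seqP => n; rewrite lee_fin.
    have zz : z n <= z n.+1.
      by rewrite /z (exprS _ n.+1); have := e0 n; nra.
    have [xy|yx] := leP x y; first by rewrite !s3.
    have [yz|zy] := leP y (z n); first by rewrite !s1//; exact: le_trans yz zz.
    have [yz'|zy'] := leP y (z n.+1).
      rewrite (s1 n.+1 y yz') (s2 n y (ltW zy) (ltW yx)).
      by rewrite ler_pdivrMr ?subr_gt0//; lra.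
    rewrite (s2 n y (ltW zy) (ltW yx)) (s2 n.+1 y (ltW zy')
      (ltW yx)) ler_wpM2l ?subr_ge0 ?(ltW yx)//.
    by rewrite lef_pV2 ?posrE ?subr_gt0//; lra.
have E n : (\int[mu1]_(y in D01) (s n y)%:E = \int[mu2]_(y in D01) (s n y)%:E)%E.
  have zn01 : 0 < z n < 1 by rewrite z0 (lt_trans (zx n)).
  pose j y := green (z n) y - green x y.
  have j0 y : 0 <= j y by rewrite subr_ge0 green_nincr// ltW.
  have mj : measurable_fun D01 (EFin \o j).
    apply/measurable_EFinP; apply: measurable_funTS.
    by apply: measurable_funB; exact: measurable_green.
  (* Finiteness of the integral of [green x] is what permits the subtraction in the extended
     reals. *)
  have D (mu : {measure set R -> \bar R}) :
      (\int[mu]_(y in D01) (green x y)%:E < +oo)%E ->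
      (\int[mu]_(y in D01) (s n y)%:E = (x - z n)^-1%:E * (\int[mu]_(y in D01) (green
        (z n) y)%:E - \int[mu]_(y in D01) (green x y)%:E))%E.
    move=> fin.
    have gge0 t y : t < 1 -> D01 y -> (0 <= (green t y)%:E)%E.
      by move=> t1; rewrite /= in_itv/= => /andP[_ y1]; rewrite lee_fin green_ge0// ltW.
    have -> : (\int[mu]_(y in D01) (green (z n) y)%:E =
      \int[mu]_(y in D01) (j y)%:E + \int[mu]_(y in D01) (green x y)%:E)%E.
      rewrite -ge0_integralD//.
      - by apply: eq_integral => y _; rewrite -EFinD subrK.
      - by move=> y _; rewrite lee_fin.
      - by move=> y; exact: gge0.
      - exact: mg.
    rewrite addeK; last first.
      by rewrite ge0_fin_numE//; apply: integral_ge0 => y; exact: gge0.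
    rewrite -ge0_integralZl//.
    - by apply: eq_integral => y _; rewrite -EFinM mulrC.
    - by move=> y _; rewrite lee_fin.
    - by rewrite lee_fin invr_ge0 subr_ge0 ltW.
  by rewrite !D ?H12// -?H12// Hfin.
have C1 := C mu1; have C2 := C mu2.
move: C1; under eq_cvg do rewrite E.
by move=> C1; rewrite -(cvg_lim _ C1)// -(cvg_lim _ C2).
Qed.

Lemma cvg_measure_D01 mu :
  mu `]0, 1 - (1 / 2) ^+ n.+1[%classic @[n --> \oo] --> mu D01.
Proof.
pose F n : set R := `]0, 1 - (1 / 2) ^+ n.+1[%classic.
have e0 n : 0 < (1 / 2) ^+ n.+1 :> R by rewrite exprn_gt0.
have FU : \bigcup_n F n = D01.
  apply/seteqP; split => [y [n _]|y]; rewrite /F /= !in_itv/=.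
    by have := e0 n; move=> e /andP[-> yn]; lra.
  move=> /andP[y0 y1].
  have C : geometric (1 / 2) (1 / 2) @ \oo --> (0:R).
    by apply: cvg_geometric; rewrite ger0_norm; lra.
  have /cvgr0_norm_lt/(_ (1 - y)) := C; rewrite subr_gt0 => /(_ y1)[N _ /(_ N (leqnn N))].
  rewrite /= -exprS ger0_norm ?(ltW (e0 N))// => h.
  by exists N => //=; rewrite in_itv/= y0; lra.
have ndF : nondecreasing_seq F.
  apply/nondecreasing_seqP => n; apply/subsetPset; apply: subset_itvl.
  by rewrite bnd_simp (exprS _ n.+1); have := e0 n; lra.
rewrite -FU; apply: (nondecreasing_cvg_mu (F := F)) => //.
+ by move=> n; exact: measurable_itv.
+ by apply: bigcup_measurable => n _; exact: measurable_itv.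
Qed.

(** Agreement on the intervals ]0, x[ gives agreement on the open left half-lines, a generating
    family stable under intersection; the finite mass of [mu1] supplies the finiteness required by
    uniqueness of measures. *)
Lemma green_determines mu1 mu2 :
  mu1 (~` D01) = 0%E -> mu2 (~` D01) = 0%E -> (mu1 D01 < +oo)%E ->
  (forall z, 0 < z < 1 -> (\int[mu1]_(y in D01) (green z y)%:E =
    \int[mu2]_(y in D01) (green z y)%:E)%E) ->
  (forall z, 0 < z < 1 -> (\int[mu1]_(y in D01) (green z y)%:E < +oo)%E) ->
  forall A, measurable A -> mu1 A = mu2 A.
Proof.
move=> n1 n2 fin1 H12 Hfin.
have E01 x : 0 < x < 1 -> mu1 `]0, x[%classic = mu2 `]0, x[%classic.
  by move=> x01; exact: green_determines_itv.
have mD : measurable D01 by exact: measurable_itv.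
have ED : mu1 D01 = mu2 D01.
  have e0 n : 0 < (1 / 2) ^+ n.+1 :> R by rewrite exprn_gt0.
  have e1 n : (1 / 2) ^+ n.+1 < 1 :> R by rewrite exprn_ilt1//; lra.
  have C1 := cvg_measure_D01 (mu := mu1); have C2 := cvg_measure_D01 (mu := mu2).
  have EF : (fun n => mu1 `]0, 1 - (1 / 2) ^+ n.+1[%classic) =
            (fun n => mu2 `]0, 1 - (1 / 2) ^+ n.+1[%classic).
    by apply/funext => n; apply: E01; have := e0 n; have := e1 n; lra.
  by move: C1; rewrite EF => C1; rewrite -(cvg_lim _ C1)// -(cvg_lim _ C2).
have split (mu : {measure set R -> \bar R}) A : mu (~` D01) = 0%E -> measurable A -> mu A =
  mu (A `&` D01).
  move=> n mA; rewrite (measureDI mu mA mD) [X in (X + _)%E](_ : _ = 0%E) ?add0e//.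
  apply: (subset_measure0 _ _ _ n); [exact: measurableD|exact: measurableC|].
  by move=> y [].
have itvE x : mu1 (`]-oo, x[ `&` D01) = mu2 (`]-oo, x[ `&` D01).
  have [x0|x0] := leP x 0.
    rewrite (_ : _ `&` _ = set0) ?measure0//.
    by apply/seteqP; split => // y /=; rewrite !in_itv/= => -[yx /andP[y0 _]]; clear -x0 yx y0; lra.
  have [x1|x1] := leP 1 x.
    by rewrite (_ : _ `&` _ = D01)//; apply/setIidPr => y /=; rewrite !in_itv/= => /andP[_ y1];
      clear -x1 y1; lra.
  rewrite (_ : _ `&` _ = `]0, x[%classic); first by apply: E01; rewrite x0.
  apply/seteqP; split => y /=; rewrite !in_itv/=; first by move=> [-> /andP[-> _]].
  by move=> /andP[-> yx]; split => //; exact: lt_trans yx x1.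
apply: (measure_unique (@RGenInftyO.G R) (fun n => `]-oo, n%:R[%classic)).
- exact: RGenInftyO.measurableE.
- move=> _ _ [x ->] [y ->]; exists (Num.min x y).
  apply/seteqP; split => t /=; rewrite !in_itv/= lt_min; first by move=> [-> ->].
  by move=> /andP[].
- by move=> n; exists n%:R.
- apply/seteqP; split => // y _; exists (Num.trunc `|y|).+1 => //=.
  rewrite in_itv/=; apply: (le_lt_trans (ler_norm y)).
  by rewrite truncnS_gt.
- by move=> _ [x ->]; rewrite (split mu1)// (split mu2).
- move=> n; rewrite (split mu1)//; apply: le_lt_trans fin1.
  by apply: le_measure; rewrite ?inE//; apply: measurableI.
Qed.

End Determination.

(** * Maximization over densities *)

(* With [S] and [dl] the sum and distance of the roots and [q] the root of the mean,
   [4 q^2 = S^2 + dl^2] gives [q - S / 2 >= dl^2 / (6 S)]; conclude by AM-GM. *)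
Lemma sqrt_gap (R : rcfType) (f g e : R) : 0 <= f -> 0 <= g -> 0 < e ->
  `|Num.sqrt f - Num.sqrt g| <= e * (Num.sqrt f + Num.sqrt g) +
     3 / (2 * e) * (Num.sqrt ((f + g) / 2) - (Num.sqrt f + Num.sqrt g) / 2).
Proof.
move=> f0 g0 e0.
set q := Num.sqrt ((f + g) / 2).
have q0 : 0 <= q by exact: sqrtr_ge0.
have qq : q ^+ 2 = (f + g) / 2 by rewrite sqr_sqrtr// divr_ge0// addr_ge0.
set a := Num.sqrt f in qq *; set b := Num.sqrt g in qq *.
have a0 : 0 <= a by exact: sqrtr_ge0.
have b0 : 0 <= b by exact: sqrtr_ge0.
have fa : f = a ^+ 2 by rewrite sqr_sqrtr.
have gb : g = b ^+ 2 by rewrite sqr_sqrtr.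
rewrite {}fa {}gb in qq.
set S := a + b; set dl := `|a - b|.
have d0 : 0 <= dl by exact: normr_ge0.
have dd : dl ^+ 2 = (a - b) ^+ 2 by rewrite real_normK ?num_real.
have q4 : 4 * q ^+ 2 = S ^+ 2 + dl ^+ 2 by rewrite qq dd /S; field.
have S0 : 0 <= S by rewrite addr_ge0.
have dS : dl <= S.
  by rewrite /dl ler_norml /S; apply/andP; split; lra.
have Sq : S <= 2 * q.
  have h : S ^+ 2 <= (2 * q) ^+ 2 by rewrite exprMn; have := sqr_ge0 dl; lra.
  by rewrite -(@ler_pXn2r _ 2) ?nnegrE ?mulr_ge0.
have qS : q <= S.
  have h : dl ^+ 2 <= S ^+ 2 by rewrite ler_pXn2r ?nnegrE.
  have h2 : q ^+ 2 <= S ^+ 2 by have := sqr_ge0 S; lra.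
  by rewrite -(@ler_pXn2r _ 2) ?nnegrE.
suff : 2 * e * dl <= 2 * e ^+ 2 * S + 3 * (q - S / 2).
  have -> : 3 / (2 * e) * (q - S / 2) = (3 * (q - S / 2)) / (2 * e).
    by field; rewrite gt_eqF.
  move=> H; rewrite -lerBlDl ler_pdivlMr ?mulr_gt0//; lra.
have gap : dl ^+ 2 / 2 <= 3 * (q - S / 2) * S.
  have : (q - S / 2) * (q + S / 2) = dl ^+ 2 / 4 by lra.
  have : (q - S / 2) * (q + S / 2) <= (q - S / 2) * (3 * S / 2) by rewrite ler_wpM2l; lra.
  lra.
have := S0; rewrite le_eqVlt => /predU1P[S00|Sp].
  have -> : dl = 0 by apply/eqP; rewrite eq_le d0 S00 dS.
  by rewrite -S00; lra.
rewrite -(ler_pM2r Sp).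
have : 0 <= (2 * e * S - dl) ^+ 2 by exact: sqr_ge0.
lra.
Qed.

Section Maximize.
Variable R : realType.
Local Notation leb := (@lebesgue_measure R).
Local Notation D01 := (`]0%R, 1%R[%classic : set R).
Implicit Types (f g C : R -> R).

(** With [C] the later [budget], the inequality says [eta >= xi] on ]0, 1[ for the [eta] with second
    derivative [f] and the prescribed data at 0 and 1. The integral is extended-valued, so that
    integrability is a consequence and not a condition. *)
Definition feasible C f := [/\ forall y, 0 <= f y, measurable_fun setT f &
  forall x, 0 < x < 1 -> (\int[leb]_(y in D01) (green x y * f y)%:E <= (C x)%:E)%E].

Definition sqrt_mass f : R := \int[leb]_(y in D01) Num.sqrt (f y).

Let mD : measurable D01. Proof. exact: measurable_itv. Qed.

Let measD f : measurable_fun setT f -> measurable_fun D01 (EFin \o f).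
Proof. by move=> mf; apply/measurable_EFinP; exact: measurable_funTS. Qed.

Lemma measurable_sqrtr f : measurable_fun setT f -> measurable_fun setT (fun y => Num.sqrt (f y)).
Proof.
by move=> mf; apply: (measurableT_comp _ mf); apply: continuous_measurable_fun; exact:
  sqrt_continuous.
Qed.

Lemma measurable_green_mul x f : measurable_fun setT f ->
  measurable_fun setT (fun y => green x y * f y).
Proof. by move=> mf; apply: measurable_funM => //; exact: measurable_green. Qed.

Let green0 x y : 0 < x < 1 -> D01 y -> 0 <= green x y.
Proof. by move=> /andP[_ x1]; rewrite /= in_itv/= => /andP[_ y1]; rewrite green_ge0// ltW. Qed.

Lemma feasible_avg C f g : feasible C f -> feasible C g -> feasible C (fun y => (f y + g y) / 2).
Proof.
move=> [f0 mf fC] [g0 mg gC]; split.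
- by move=> y; rewrite divr_ge0// addr_ge0.
- by apply: measurable_funM => //; exact: measurable_funD.
- move=> x x01.
  have -> : (\int[leb]_(y in D01) (green x y * ((f y + g y) / 2))%:E =
     (1 / 2)%:E * (\int[leb]_(y in D01) (green x y * f y)%:E + \int[leb]_(y in D01)
       (green x y * g y)%:E))%E.
    have p y : D01 y -> (0 <= (green x y * f y)%:E)%E by move=> Dy; rewrite lee_fin mulr_ge0//
      green0.
    have p' y : D01 y -> (0 <= (green x y * g y)%:E)%E by move=> Dy; rewrite lee_fin mulr_ge0//
      green0.
    have m1 := measD (measurable_green_mul x mf); have m2 := measD (measurable_green_mul x mg).
    rewrite -ge0_integralD//= -ge0_integralZl//=.
    - by apply: eq_integral => y _; rewrite -EFinD -EFinM; congr EFin; field.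
    - exact: emeasurable_funD.
    - by move=> y Dy; apply: adde_ge0; [exact: p|exact: p'].
  have -> : C x = 1 / 2 * (C x + C x) by field.
  by rewrite [leRHS]EFinM EFinD lee_pmul2l// leeD// ?fC ?gC.
Qed.

Section Bounded.
Variables (C : R -> R) (M : R).
Hypothesis (HM : forall x, 0 < x < 1 -> C x <= M * (1 - x)).

(** On ]0, x[ the kernel [green x] is the constant [1 - x], so [(1 - x)] times the mass of ]0, x[ is
    at most [C x <= M (1 - x)]. The factor [1 - x] cancels, and [x] tends to 1. *)
Lemma feasible_mass f : feasible C f -> (\int[leb]_(y in D01) (f y)%:E <= M%:E)%E.
Proof.
move=> [f0 mf fC].
have e0 n : 0 < (1 / 2) ^+ n.+1 :> R by rewrite exprn_gt0.
have e1 n : (1 / 2) ^+ n.+1 < 1 :> R by rewrite exprn_ilt1//; lra.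
pose dm : {measure set R -> \bar R} := density_measure (lebR R) f0 mf.
have cv := cvg_measure_D01 (mu := dm).
have dmE A : measurable A -> dm A = (\int[leb]_(y in A) (f y)%:E)%E.
  move=> mA; rewrite /dm/= /density_measure ge0_integral_lebR//.
  - by apply/measurable_EFinP; exact: measurable_funTS.
  - by move=> y _; rewrite lee_fin.
rewrite -dmE//.
rewrite -(cvg_lim _ cv)//; apply: lime_le; first by apply/cvg_ex; exists (dm D01).
apply: nearW => n; rewrite dmE//.
set x := 1 - (1 / 2) ^+ n.+1.
have x01 : 0 < x < 1 by rewrite /x; have := e0 n; have := e1 n; lra.
move: (x01) => /andP[x0 x1].
have sub : `]0, x[%classic `<=` D01 by apply: subset_itvl; rewrite bnd_simp ltW.
have x1' : 0 < 1 - x by lra.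
rewrite -(@lee_pmul2l _ (1 - x)%:E)//.
rewrite -ge0_integralZl//; last 3 first.
- by apply/measurable_EFinP; exact: measurable_funTS.
- by move=> y _; rewrite lee_fin.
- by rewrite lee_fin ltW.
have mgf : measurable_fun `]0, x[ (fun y => (green x y * f y)%:E).
  by apply/measurable_EFinP; apply: measurable_funTS; exact: measurable_green_mul.
apply: (@le_trans _ _ (\int[leb]_(y in `]0%R, x[) (green x y * f y)%:E)%E).
  apply: ge0_le_integral => //.
  - by move=> y _; rewrite -EFinM lee_fin mulr_ge0// ltW.
  - apply: emeasurable_funM => //.
    by apply/measurable_EFinP; exact: measurable_funTS.
  - move=> y /=; rewrite in_itv/= => /andP[y0 yx]; rewrite -EFinM lee_fin ler_wpM2r//.
    by rewrite /green max_l// ltW.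
apply: (@le_trans _ _ (\int[leb]_(y in D01) (green x y * f y)%:E)%E).
  apply: ge0_subset_integral => //; first exact: (measD (measurable_green_mul x mf)).
  by move=> y Dy; rewrite lee_fin mulr_ge0// green0.
by apply: (le_trans (fC _ x01)); rewrite -EFinM lee_fin mulrC HM.
Qed.

Lemma feasible_integrable f : feasible C f -> leb.-integrable D01 (EFin \o f).
Proof.
move=> ff; have [f0 mf _] := ff; apply/integrableP; split; first exact: measD.
apply: le_lt_trans (ltry M); apply: le_trans (feasible_mass ff).
rewrite le_eqVlt; apply/orP; left; apply/eqP; apply: eq_integral => y _.
by rewrite /= ger0_norm.
Qed.

Let cst_integrable (r : R) : leb.-integrable D01 (EFin \o cst r).
Proof.
apply: measurable_bounded_integrable => //.
- by rewrite /= lebesgue_measure_itv/= lte_fin ltr01 -EFinB ltry.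
- exact: bounded_cst.
Qed.

Lemma sqrtr_le_1D (x : R) : 0 <= x -> Num.sqrt x <= 1 + x.
Proof.
move=> x0; have := sqr_sqrtr x0; have := sqrtr_ge0 x; move: (Num.sqrt x) => s s0 sx; nra.
Qed.

Let one_plus_integrable f : feasible C f -> leb.-integrable D01 (EFin \o (fun y => 1 + f y)).
Proof.
move=> ff; rewrite (_ : EFin \o _ = ((EFin \o cst 1%R) \+ (EFin \o f))%E)//.
by apply: integrableD => //; exact: feasible_integrable.
Qed.

Lemma sqrt_integrable f : feasible C f -> leb.-integrable D01 (EFin \o (fun y => Num.sqrt (f y))).
Proof.
move=> ff; have [f0 mf _] := ff.
apply: le_integrable (one_plus_integrable ff) => //.
  by apply: measD; exact: measurable_sqrtr.
move=> y Dy; rewrite lee_fin /= !ger0_norm ?sqrtr_ge0 ?addr_ge0//.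
exact: sqrtr_le_1D.
Qed.

Lemma sqrt_mass_le f : feasible C f -> sqrt_mass f <= 1 + M.
Proof.
move=> ff; have [f0 mf _] := ff.
apply: (@le_trans _ _ (\int[leb]_(y in D01) (1 + f y))).
  apply: le_Rintegral => //; first exact: sqrt_integrable.
    exact: one_plus_integrable.
  by move=> y _; exact: sqrtr_le_1D.
rewrite (RintegralD (f1 := fun=> 1))//; [|exact: cst_integrable|exact: feasible_integrable].
rewrite lerD//.
  by rewrite Rintegral_cst//= lebesgue_measure_itv/= lte_fin ltr01 -EFinB/=; lra.
rewrite -lee_fin /Rintegral fineK; first exact: feasible_mass.
by apply: integrable_fin_num => //; exact: feasible_integrable.
Qed.

Lemma sqrt_mass_ge0 f : 0 <= sqrt_mass f.
Proof. by apply: Rintegral_ge0 => y _; exact: sqrtr_ge0. Qed.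

End Bounded.
End Maximize.

(** * Existence and uniqueness of the maximal density *)

Section Maximizer.
Variable R : realType.
Local Notation leb := (@lebesgue_measure R).
Local Notation D01 := (`]0%R, 1%R[%classic : set R).
Implicit Types (f g : R -> R).
Variables (C : R -> R) (M : R).
Hypothesis (HM : forall x, 0 < x < 1 -> C x <= M * (1 - x)).

Let mD : measurable D01. Proof. exact: measurable_itv. Qed.

Let measD f : measurable_fun setT f -> measurable_fun D01 (EFin \o f).
Proof. by move=> mf; apply/measurable_EFinP; exact: measurable_funTS. Qed.

Let sqrt_int f : feasible C f -> leb.-integrable D01 (EFin \o (fun y => Num.sqrt (f y))).
Proof. move=> ff; exact: (sqrt_integrable HM ff). Qed.

Definition sqrt_mass_sup : R := sup [set sqrt_mass f | f in feasible C].

Lemma sqrt_mass_le_sup f : feasible C f -> sqrt_mass f <= sqrt_mass_sup.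
Proof.
move=> ff; apply: ub_le_sup; last by exists f.
by exists (1 + M) => _ [g fg <-]; exact: (sqrt_mass_le HM fg).
Qed.

Let diff_integrable f g : feasible C f -> feasible C g ->
  leb.-integrable D01 (EFin \o (fun y => `|Num.sqrt (f y) - Num.sqrt (g y)|)).
Proof.
move=> ff fg; have [_ mf _] := ff; have [_ mg _] := fg.
have i : leb.-integrable D01 (EFin \o (fun y => Num.sqrt (f y) + Num.sqrt (g y))).
  rewrite (_ : EFin \o _ = ((EFin \o (fun y => Num.sqrt (f y))) \+
    (EFin \o (fun y => Num.sqrt (g y))))%E)//.
  by apply: integrableD => //; exact: sqrt_int.
apply: le_integrable i => //.
  apply: measD; apply: measurableT_comp => //.
  by apply: measurable_funB; exact: measurable_sqrtr.
move=> y _; rewrite /= lee_fin normr_id.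
rewrite (ger0_norm (addr_ge0 (sqrtr_ge0 _) (sqrtr_ge0 _))).
by rewrite ler_norml; have := sqrtr_ge0 (f y); have := sqrtr_ge0 (g y); lra.
Qed.

(** Integration of [sqrt_gap]: the average of [f] and [g] is feasible, so its [sqrt_mass] exceeds
    the mean of the two others by at most [t]. The parameter [e] stays free, to be balanced against
    [t]. *)
Lemma sqrt_mass_cauchy f g (e t : R) : feasible C f -> feasible C g -> 0 < e ->
  sqrt_mass_sup - t <= sqrt_mass f -> sqrt_mass_sup - t <= sqrt_mass g ->
  \int[leb]_(y in D01) `|Num.sqrt (f y) - Num.sqrt (g y)| <=
    e * (2 * sqrt_mass_sup) + 3 / (2 * e) * t.
Proof.
move=> ff fg e0 tf tg.
have fh := feasible_avg ff fg.
(* Coefficients of the two roots and of the root of the mean in [sqrt_gap], so that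
   [A = e - B / 2]. *)
pose A := e - 3 / (4 * e); pose B := 3 / (2 * e).
have B0 : 0 <= B by rewrite divr_ge0// mulr_ge0// ltW.
have Z f' r : feasible C f' -> leb.-integrable D01 (EFin \o (fun y => r * Num.sqrt (f' y))).
  move=> ff'; rewrite (_ : EFin \o _ = (fun y => r%:E * (EFin \o (fun y => Num.sqrt
    (f' y))) y)%E)//.
  by apply: integrableZl => //; exact: sqrt_int.
have Z2 : leb.-integrable D01 (EFin \o (fun y => A * Num.sqrt (f y) + A * Num.sqrt (g y))).
  rewrite (_ : EFin \o _ = ((EFin \o (fun y => (A * Num.sqrt (f y))%R)) \+
    (EFin \o (fun y => (A * Num.sqrt (g y))%R)))%E)//.
  by apply: integrableD => //; exact: Z.
have Z3 : leb.-integrable D01 (EFin \o (fun y => (A * Num.sqrt (f y) + A * Num.sqrt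
  (g y)) + B * Num.sqrt ((f y + g y) / 2))).
  rewrite (_ : EFin \o _ = ((EFin \o (fun y => (A * Num.sqrt (f y) + A * Num.sqrt (g y))%R)) \+
    (EFin \o (fun y => (B * Num.sqrt ((f y + g y) / 2))%R)))%E)//.
  by apply: integrableD => //; exact: (Z (fun y => (f y + g y) / 2)).
apply: (@le_trans _ _ (\int[leb]_(y in D01) ((A * Num.sqrt (f y) + A * Num.sqrt
  (g y)) + B * Num.sqrt ((f y + g y) / 2)))).
  apply: le_Rintegral => //; first exact: diff_integrable.
  move=> y _; have [f0 _ _] := ff; have [g0 _ _] := fg.
  apply: (le_trans (sqrt_gap (f0 y) (g0 y) e0)).
  by rewrite le_eqVlt; apply/orP; left; apply/eqP; rewrite /A /B; field; rewrite gt_eqF.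
rewrite RintegralD//; last exact: (Z (fun y => (f y + g y) / 2)).
rewrite RintegralD//; [|exact: Z..].
rewrite !RintegralZl//; [|exact: (sqrt_int fh)|exact: sqrt_int..].
rewrite -[\int[leb]_(x in D01) Num.sqrt (f x)]/(sqrt_mass f).
rewrite -[\int[leb]_(x in D01) Num.sqrt (g x)]/(sqrt_mass g).
rewrite -[\int[leb]_(x in D01) Num.sqrt ((f x + g x) / 2)]/(sqrt_mass (fun y => (f y + g y) / 2)).
have sf := sqrt_mass_le_sup ff; have sg := sqrt_mass_le_sup fg; have sh := sqrt_mass_le_sup fh.
move: (sqrt_mass f) (sqrt_mass g) (sqrt_mass (fun y =>
  (f y + g y) / 2)) sqrt_mass_sup sf sg sh tf tg => a b c s sf sg sh tf tg.
have -> : A * a + A * b + B * c = e * (a + b) + B * (c - (a + b) / 2).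
  by rewrite /A /B; field; rewrite gt_eqF.
rewrite -/B lerD//; last by rewrite ler_wpM2l//; lra.
by rewrite ler_wpM2l//; [exact: ltW|lra].
Qed.

(** For [t = 0] the estimate of [sqrt_mass_cauchy] is a multiple of the arbitrary [e], so the roots
    are at distance 0. *)
Lemma maximizer_unique f g : feasible C f -> feasible C g ->
  sqrt_mass f = sqrt_mass_sup -> sqrt_mass g = sqrt_mass_sup ->
  ae_eq leb D01 (EFin \o f) (EFin \o g).
Proof.
move=> ff fg sf sg; have [f0 mf _] := ff; have [g0 mg _] := fg.
pose df y := Num.sqrt (f y) - Num.sqrt (g y).
have I0 : \int[leb]_(y in D01) `|df y| = 0.
  apply/eqP; rewrite eq_le Rintegral_ge0// andbT.
  apply/ler_addgt0Pr => e e0; rewrite add0r.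
  pose s := sqrt_mass_sup.
  have s0 : 0 <= s by rewrite /s -sf sqrt_mass_ge0.
  have e'0 : 0 < e / (2 * s + 1) by rewrite divr_gt0//; lra.
  apply: (le_trans (sqrt_mass_cauchy ff fg e'0 (t := 0) _ _)); rewrite ?subr0 ?sf ?sg//.
  rewrite mulr0 addr0 -/s mulrAC ler_pdivrMr; last lra.
  by rewrite ler_wpM2l ?(ltW e0)//; lra.
have mdf : measurable_fun setT df by apply: measurable_funB; exact: measurable_sqrtr.
have : (\int[leb]_(y in D01) `|(df y)%:E| = 0)%E.
  have : (\int[leb]_(y in D01) `|df y|%:E)%E \is a fin_num.
    by apply: integrable_fin_num => //; exact: (diff_integrable ff fg).
  by move=> /fineK <-; congr EFin; exact: I0.
move=> /(ae_eq_integral_abs leb mD (measD mdf)).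
apply: filterS => y H Dy; have /= [] := H Dy.
move=> /eqP; rewrite subr_eq0 => /eqP h; congr EFin.
by rewrite -[f y]sqr_sqrtr// h sqr_sqrtr.
Qed.

(** The deficits are chosen as squares of [(1 / 2) ^+ n]: taking [e = (1 / 2) ^+ n] in
    [sqrt_mass_cauchy] balances both terms and bounds consecutive distances by [K (1 / 2) ^+ n].
    These are summable, so convergence holds almost everywhere without passing to a subsequence. *)
Lemma maximizer_exists : (exists f, feasible C f) ->
  exists2 f, feasible C f & sqrt_mass f = sqrt_mass_sup.
Proof.
move=> [phi0 fphi0].
pose s := sqrt_mass_sup.
have s0 : 0 <= s by apply: le_trans (sqrt_mass_le_sup fphi0); exact: sqrt_mass_ge0.
have hn0 n : 0 < (1 / 2) ^+ n :> R by rewrite exprn_gt0.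
have /choice[F HF] : forall n : nat, exists f, feasible C f /\ s - ((1 / 2) ^+ n) ^+ 2 <=
  sqrt_mass f.
  move=> n; have t0 : 0 < ((1 / 2) ^+ n) ^+ 2 :> R by rewrite exprn_gt0.
  have [|_ [f ff <-] lt] := @sup_adherent _ [set sqrt_mass f | f in feasible C]
    (((1 / 2) ^+ n) ^+ 2) t0.
    split; first by exists (sqrt_mass phi0); exists phi0.
    by exists (1 + M) => _ [g fg <-]; exact: (sqrt_mass_le HM fg).
  by exists f; split => //; exact: ltW.
have fF n : feasible C (F n) := (HF n).1.
have F0 n y : 0 <= F n y by have [] := fF n.
have mF n : measurable_fun setT (F n) by have [] := fF n.
pose u n y := Num.sqrt (F n y).
have mu' n : measurable_fun setT (u n) by exact: measurable_sqrtr.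
have u0 n y : 0 <= u n y by exact: sqrtr_ge0.
pose dd n y := `|u n.+1 y - u n y|.
have dd0 n y : 0 <= dd n y by exact: normr_ge0.
have mdd n : measurable_fun D01 (fun y => (dd n y)%:E).
  by apply: measD; apply: measurableT_comp => //; exact: measurable_funB.
pose K := 2 * s + 3 / 2.
have K0 : 0 <= K by rewrite /K; lra.
have ddK n : (\int[leb]_(y in D01) (dd n y)%:E <= (K * (1 / 2) ^+ n)%:E)%E.
  have : (\int[leb]_(y in D01) (dd n y)%:E)%E \is a fin_num.
    by apply: integrable_fin_num => //; exact: (diff_integrable (fF n.+1) (fF n)).
  move=> /fineK <-; rewrite lee_fin.
  have h1 : sqrt_mass_sup - ((1 / 2) ^+ n) ^+ 2 <= sqrt_mass (F n.+1).
    apply: le_trans (HF n.+1).2; rewrite lerD2l lerN2 [(1 / 2) ^+ n.+1]exprS.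
    by have := hn0 n; nra.
  apply: (le_trans (sqrt_mass_cauchy (fF n.+1) (fF n) (hn0 n) h1 (HF n).2)).
  rewrite -/s /K le_eqVlt; apply/orP; left; apply/eqP; field.
  by rewrite gt_eqF.
(* The total variation of the sequence of roots at [y]. It is integrable, so the roots converge
   wherever it is finite, and [u 0 + G] dominates all of them. *)
pose G y := (\sum_(0 <= n <oo) (dd n y)%:E)%E.
have mG : measurable_fun D01 G.
  apply: ge0_emeasurable_sum => [n y _ _|n _]; last exact: mdd.
  by rewrite lee_fin dd0.
have intG : (\int[leb]_(y in D01) G y < +oo)%E.
  rewrite /G integral_nneseries//; last by move=> n y _; rewrite lee_fin dd0.
  apply: (@le_lt_trans _ _ (\sum_(0 <= n <oo) (K * (1 / 2) ^+ n)%:E)%E).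
    apply: lee_nneseries => [n _ _|n _].
      by apply: integral_ge0 => y _; rewrite lee_fin dd0.
    exact: ddK.
  have Kge0 n : (0 <= (K * (1 / 2) ^+ n)%:E)%E by rewrite lee_fin mulr_ge0// ltW.
  apply: (@le_lt_trans _ _ (2 * K)%:E); last exact: ltry.
  apply: lime_le; first by apply: is_cvg_nneseries => n _ _.
  apply: nearW => n; rewrite sumEFin lee_fin.
  have -> : \sum_(0 <= i < n) K * (1 / 2) ^+ i = 2 * K * (1 - (1 / 2) ^+ n).
    elim: n => [|n IH]; first by rewrite big_nil expr0 subrr mulr0.
    by rewrite big_nat_recr//= IH exprS; field.
  by rewrite ler_piMr ?mulr_ge0// lerBlDr lerDl ltW.
have G0 y : (0 <= G y)%E by apply: nneseries_ge0 => n _ _; rewrite lee_fin dd0.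
have iG : leb.-integrable D01 G.
  apply/integrableP; split => //; apply: le_lt_trans intG.
  rewrite le_eqVlt; apply/orP; left; apply/eqP; apply: eq_integral => y _.
  by rewrite gee0_abs.
have partial n y : (\sum_(0 <= k < n) (dd k y)%:E <= G y)%E.
  by apply: nneseries_lim_ge => k _ _; rewrite lee_fin dd0.
have ubound n y : (`|(u n y)%:E| <= (u 0%N y)%:E + G y)%E.
  rewrite /= ger0_norm//.
  apply: (@le_trans _ _ ((u 0%N y)%:E + \sum_(0 <= k < n) (dd k y)%:E)%E); last first.
    by rewrite leeD2l.
  rewrite sumEFin -EFinD lee_fin.
  elim: n => [|n IH]; first by rewrite big_nil addr0.
  rewrite big_nat_recr//=.
  have : u n.+1 y - u n y <= dd n y by exact: ler_norm.
  lra.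
have ucvg y : G y \is a fin_num -> cvgn (u ^~ y).
  move=> Gfin.
  have /normed_cvg : cvgn (series (fun k => dd k y)).
    apply: nondecreasing_is_cvgn.
      apply/nondecreasing_seqP => n.
      by rewrite /series /= big_nat_recr//= lerDl dd0.
    exists (fine (G y)) => _ [n _ <-].
    by rewrite -lee_fin fineK// /series /= -sumEFin.
  rewrite (_ : series _ = series (telescope (u ^~ y)))// => cv.
  rewrite (_ : u ^~ y = (fun n => u 0%N y + series (telescope (u ^~ y)) n)); last first.
    by apply/funext => n; exact: eq_sum_telescope.
  by apply: is_cvgD => //; exact: is_cvg_cst.
(* An upper limit is measurable and defined even where the sequence diverges; the absolute value
   makes [f] nonnegative everywhere, as [feasible] demands. *)
pose f y := `|fine (limn_esup (fun n => (F n y)%:E))|.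
have mf : measurable_fun setT f.
  apply: measurableT_comp => //; apply: (measurableT_comp (fine_measurable measurableT)).
  by apply: measurable_fun_limn_esup => n; apply/measurable_EFinP.
have f0 y : 0 <= f y by exact: normr_ge0.
have Fcvg y : G y \is a fin_num -> F ^~ y @ \oo --> f y.
  move=> /ucvg ul; set l := limn (u ^~ y) in ul.
  have Fl : F ^~ y @ \oo --> l * l.
    rewrite (_ : F ^~ y = (fun n => u n y * u n y)); first by apply: cvgM; exact: ul.
    by apply/funext => n; rewrite -expr2 sqr_sqrtr.
  have EFl : (fun n => (F n y)%:E) @ \oo --> (l * l)%:E.
    by apply: cvg_EFin; first exact: nearW.
  by rewrite /f (cvg_limn_einf_sup EFl).2 /= ger0_norm// -expr2 sqr_ge0.
have aeG : \forall y \ae leb, D01 y -> G y \is a fin_num by exact: integrable_ae.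
have ff : feasible C f.
  split => // x x01.
  have gF0 n y : D01 y -> (0 <= (green x y * F n y)%:E)%E.
    move=> /=; rewrite in_itv/= => /andP[_ y1]; rewrite lee_fin mulr_ge0// green_ge0//;
      last exact: ltW.
    by move: x01 => /andP[_ /ltW].
  have mgF n : measurable_fun D01 (fun y => (green x y * F n y)%:E).
    by apply: measD; exact: measurable_green_mul.
  have mlim : measurable_fun D01 (fun y => limn_einf (fun n => (green x y * F n y)%:E)).
    apply: measurableT_comp => //; apply: measurable_fun_limn_esup => n.
    by apply: measurableT_comp.
  have -> : (\int[leb]_(y in D01) (green x y * f y)%:E =
      \int[leb]_(y in D01) limn_einf (fun n => (green x y * F n y)%:E))%E.
    apply: ae_eq_integral => //; first by apply: measD; exact: measurable_green_mul.
    apply: (@filterS _ _ (ae_filter_ringOfSetsType leb) _ _ _ aeG) => y Gy Dy; have :=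
      Fcvg y (Gy Dy) => Fy.
    have EFl : (fun n => (green x y * F n y)%:E) @ \oo --> (green x y * f y)%:E.
      by apply: cvg_EFin; [exact: nearW|exact: cvgn_Ml].
    by rewrite (cvg_limn_einf_sup EFl).1.
  apply: le_trans (fatou leb mD mgF gF0) _.
  rewrite limn_einf_lim; apply: lime_le; first exact: is_cvg_einfs.
  apply: nearW => n; apply: (@le_trans _ _ (\int[leb]_(y in D01) (green x y * F n y)%:E)%E).
    by apply: ereal_inf_lbound; exists n => /=.
  by have [_ _] := fF n; apply.
exists f => //; apply/eqP; rewrite eq_le sqrt_mass_le_sup//=.
(* Fatou gives only feasibility of [f]. That no [sqrt_mass] is lost in the limit comes from
   dominated convergence with this bound. *)
have i0 : leb.-integrable D01 (fun y => (u 0%N y)%:E + G y)%E.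
  by apply: integrableD => //; exact: sqrt_int.
have msf : measurable_fun D01 (fun y => (Num.sqrt (f y))%:E).
  by apply: measD; exact: measurable_sqrtr.
have cvae : \forall y \ae leb, D01 y -> (u n y)%:E @[n --> \oo] --> (Num.sqrt (f y))%:E.
  apply: (@filterS _ _ (ae_filter_ringOfSetsType leb) _ _ _ aeG) => y Gy Dy; have Fy :=
    Fcvg y (Gy Dy).
  apply: cvg_EFin; first exact: nearW.
  exact: (cvg_comp _ _ Fy (@sqrt_continuous R (f y))).
have domae : \forall y \ae leb, forall n : nat, D01 y -> (`|(u n y)%:E| <= (u 0%N y)%:E + G y)%E.
  by apply: aeW => y n _; exact: ubound.
have [_ _ cv] := @dominated_convergence _ _ _ leb D01 mD (fun n y => (u n y)%:E)
  (fun y => (Num.sqrt (f y))%:E) _ (fun n => measD (mu' n)) msf cvae i0 domae.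
have cvJ : (fun n => sqrt_mass (F n)) @ \oo --> sqrt_mass f.
  have fin1 : (\int[leb]_(y in D01) (Num.sqrt (f y))%:E)%E \is a fin_num.
    by apply: integrable_fin_num => //; exact: sqrt_int.
  apply: fine_cvg; rewrite /sqrt_mass /Rintegral fineK//.
have cvs : (fun n => s - ((1 / 2) ^+ n) ^+ 2) @ \oo --> s.
  rewrite -[X in _ --> X]subr0; apply: cvgn_B; first exact: cvgn_cst.
  have c0 : (fun n => (1 / 2 : R) ^+ n) @ \oo --> (0 : R).
    by apply: cvg_expr; rewrite ger0_norm; lra.
  by rewrite -[X in _ --> X](mulr0 0); under eq_fun do rewrite expr2; exact: cvgM.
by apply: (cvgn_le cvs cvJ); apply: nearW => n; exact: (HF n).2.
Qed.

End Maximizer.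

(** * Potentials of densities *)

Section Potential.
Variable R : realType.
Local Notation leb := (@lebesgue_measure R).
Local Notation D01 := (`]0%R, 1%R[%classic : set R).
Local Notation I01 := (`[0%R, 1%R]%classic : set R).
Variable g : R -> R.
Hypotheses (g0 : forall y, 0 <= g y) (mg : measurable_fun setT g)
  (gint : leb.-integrable setT (EFin \o g)) (gout : forall y, ~ D01 y -> g y = 0).

Let mD : measurable D01. Proof. exact: measurable_itv. Qed.

Let gint' : leb.-integrable D01 (EFin \o g).
Proof. exact: integrableS gint. Qed.

Definition potential (x : R) : R := \int[leb]_(y in D01) (green x y * g y).

Lemma green_norm x y : D01 y -> `|green x y| <= 1 + `|x|.
Proof.
rewrite /= in_itv/= => /andP[y0 y1]; rewrite /green ler_norml.
have := ler_norm x; have := normr_ge0 x; have := ler_norm (- x); rewrite normrN.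
have [xy|yx] := leP x y; lra.
Qed.

Let bounded_mul_integrable (w : R -> R) (r : R) : measurable_fun setT w ->
  (forall y, D01 y -> `|w y| <= r) -> leb.-integrable D01 (EFin \o (fun y => w y * g y)).
Proof.
move=> mw wr.
have i : leb.-integrable D01 (EFin \o (fun y => r * g y)).
  rewrite (_ : EFin \o _ = (fun y => r%:E * (EFin \o g) y)%E)//.
  exact: integrableZl.
apply: le_integrable i => //.
  by apply/measurable_EFinP; apply: measurable_funTS; exact: measurable_funM.
move=> y Dy; rewrite /= lee_fin !normrM ler_wpM2r//.
by apply: (le_trans (wr y Dy)); exact: ler_norm.
Qed.

Lemma green_mul_integrable x : leb.-integrable D01 (EFin \o (fun y => green x y * g y)).
Proof.
apply: (bounded_mul_integrable (r := 1 + `|x|)); first exact: measurable_green.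
by move=> y; exact: green_norm.
Qed.

Lemma potentialB x x' : potential x - potential x' =
  \int[leb]_(y in D01) ((green x y - green x' y) * g y).
Proof.
rewrite /potential -RintegralB//; [|exact: green_mul_integrable..].
by apply: eq_Rintegral => y _; rewrite [RHS]mulrBl.
Qed.

Let greenB_integrable x x' :
  leb.-integrable D01 (EFin \o (fun y => (green x y - green x' y) * g y)).
Proof.
apply: (bounded_mul_integrable (r := (1 + `|x|) + (1 + `|x'|))).
  by apply: measurable_funB; exact: measurable_green.
by move=> y Dy; apply: (le_trans (ler_normB _ _)); apply: lerD; exact: green_norm.
Qed.

Lemma potential_lipschitz x x' : x <= x' ->
  0 <= potential x - potential x' <= (x' - x) * \int[leb]_(y in D01) g y.
Proof.
move=> xx'; rewrite potentialB; apply/andP; split.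
  by apply: Rintegral_ge0 => y _; rewrite mulr_ge0// subr_ge0 green_nincr.
rewrite -RintegralZl//; apply: le_Rintegral => //.
- rewrite (_ : EFin \o _ = (fun y => (x' - x)%:E * (EFin \o g) y)%E)//.
  exact: integrableZl.
- by move=> y _; rewrite ler_wpM2r// green_lipschitz.
Qed.

Lemma potential_continuous : continuous potential.
Proof.
move=> x; set m := \int[leb]_(y in D01) g y.
have m0 : 0 <= m by apply: Rintegral_ge0 => y _.
apply/cvgrPdist_le => e e0; near=> x'.
have H : `|potential x - potential x'| <= `|x - x'| * m.
  have [xx|xx] := leP x x'.
    have /andP[h1 h2] := potential_lipschitz xx.
    by rewrite ger0_norm// ler0_norm ?subr_le0// opprB.
  have /andP[h1 h2] := potential_lipschitz (ltW xx).
  by rewrite distrC ger0_norm// ger0_norm// subr_ge0 ltW.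
apply: (le_trans H).
have H2 : `|x - x'| <= e / (m + 1).
  by near: x'; apply: cvgr_dist_le; [exact: cvg_id|rewrite divr_gt0//; lra].
apply: (@le_trans _ _ (`|x - x'| * (m + 1))); first by rewrite ler_wpM2l//; lra.
by rewrite -ler_pdivlMr//; lra.
Unshelve. all: by end_near. Qed.

(** A maximum of affine functions is convex, so each [green _ y] is concave, and [g] is
    nonnegative. *)
Lemma potential_concave (x x' t : R) : 0 <= t <= 1 ->
  t * potential x + (1 - t) * potential x' <= potential (t * x + (1 - t) * x').
Proof.
move=> /andP[t0 t1]; rewrite /potential.
have Z s z : leb.-integrable D01 (EFin \o (fun y => s * (green z y * g y))).
  rewrite (_ : EFin \o _ = (fun y => s%:E * (EFin \o (fun y => (green z y * g y)%R)) y)%E)//.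
  by apply: integrableZl => //; exact: green_mul_integrable.
rewrite -!RintegralZl//; [|exact: green_mul_integrable..].
rewrite -RintegralD//; [|exact: Z..].
apply: le_Rintegral => //; last first.
- move=> y _; rewrite !mulrA -mulrDl ler_wpM2r// /green.
  have : Num.max (t * x + (1 - t) * x') y <= t * Num.max x y + (1 - t) * Num.max x' y.
    rewrite ge_max; apply/andP; split.
      by rewrite lerD// ler_wpM2l ?le_max ?lexx//; lra.
    have h1 : y <= Num.max x y by rewrite le_max lexx orbT.
    have h2 : y <= Num.max x' y by rewrite le_max lexx orbT.
    nra.
  lra.
- exact: green_mul_integrable.
- rewrite (_ : EFin \o _ = ((EFin \o (fun y => t * (green x y * g y))%R) \+
  (EFin \o (fun y => (1 - t) * (green x' y * g y))%R))%E)//.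
  by apply: integrableD => //; exact: Z.
Qed.

Lemma potential1 : potential 1 = 0.
Proof.
transitivity (\int[leb]_(y in D01) (0 : R)); last by rewrite Rintegral_cst// mul0r.
apply: eq_Rintegral => y; rewrite inE/= in_itv/= => /andP[_ y1].
by rewrite /green max_l ?subrr ?mul0r// ltW.
Qed.

(** For [y > t] the kernels [green 0] and [green t] agree, and for [y <= t] they differ by at most
    [t]. The quotient is therefore at most the mass of [g] on ]0, t]. *)
Lemma potential_slope0 : (fun t => (potential 0 - potential t) / t) @ 0^'+ --> (0 : R).
Proof.
have gi01 : leb.-integrable I01 (EFin \o g) by exact: integrableS gint.
have P := parameterized_integral_cvg_left (@ltr01 R) gi01.
have P' : (fun t : R => \int[leb]_(y in `[0, t]) g y) @ 0^'+ --> (0 : R).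
  exact: cvg_at_right_filter P.
apply: (squeeze_cvgr _ (cvg_cst 0) P'); near=> t.
have t0 : 0 < t by near: t; exact: nbhs_right_gt.
have t1 : t < 1 by near: t; apply: nbhs_right_lt.
have /andP[h1 _] := potential_lipschitz (ltW t0).
rewrite divr_ge0 ?(ltW t0)//= ler_pdivrMr// mulrC potentialB.
have gi : leb.-integrable `]0, t] (EFin \o g) by exact: integrableS gint.
rewrite -Rintegral_itv_obnd_cbnd// -RintegralZl//.
have sub : `]0, t]%classic `<=` D01.
  by move=> y /=; rewrite !in_itv/= => /andP[-> yt]; exact: le_lt_trans t1.
have -> : \int[leb]_(y in `]0, t]) (t * g y) = \int[leb]_(y in D01) ((fun y => t * g y) \_ `]0,
  t] y).
  by rewrite -Rintegral_mkcondr (setIidr sub).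
apply: le_Rintegral => //.
  have : leb.-integrable (D01 `&` `]0, t]) (EFin \o (fun y => t * g y)).
    rewrite (setIidr sub) (_ : EFin \o _ = (fun y => t%:E * (EFin \o g) y)%E)//.
    exact: integrableZl.
  by move=> /integrable_restrict; rewrite restrict_EFin; apply.
move=> y /=; rewrite in_itv/= => /andP[y0 y1]; rewrite patchE.
have [yt|ty] := leP y t.
  rewrite mem_set/=; last by rewrite in_itv/= y0.
  by rewrite ler_wpM2r// -[leRHS]subr0 green_lipschitz// ltW.
rewrite memNset/=; last by rewrite in_itv/= y0/= leNgt ty.
by rewrite /green (max_r (ltW y0)) (max_r (ltW ty)) subrr mul0r.
Unshelve. all: by end_near. Qed.

End Potential.

(** * Integration by parts against test functions *)

Section TestFunction.
Variable R : realType.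
Local Notation leb := (@lebesgue_measure R).
Local Notation D01 := (`]0%R, 1%R[%classic : set R).
Local Notation I01 := (`[0%R, 1%R]%classic : set R).

Variable phi : R -> R.
Hypothesis tphi : test_fun phi.
Let phi1 := derive1 phi.
Let phi2 := derive1n 2 phi.

Let dphi (x : R) : is_derive x 1 phi (phi1 x).
Proof. by rewrite /phi1 derive1E; apply: DeriveDef => //; exact: (tphi.1 0%N). Qed.

Let dphi1 (x : R) : is_derive x 1 phi1 (phi2 x).
Proof. by rewrite /phi2 derive1nS derive1n1 derive1E; apply: DeriveDef => //; exact:
  (tphi.1 1%N). Qed.

Lemma test_continuous n : continuous (derive1n n phi).
Proof. by move=> x; apply: differentiable_continuous; apply/derivable1_diffP; exact: tphi.1. Qed.

Let phi_out x : x <= 0 \/ 1 <= x -> phi x = 0.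
Proof.
have [a [c [a0 [ac [c1 H]]]]] := tphi.2.
by move=> [x0|x1]; apply: H; [left|right]; lra.
Qed.

Let phi1_out x : x = 0 \/ x = 1 -> phi1 x = 0.
Proof.
have [a [c [a0 [ac [c1 H]]]]] := tphi.2 => x01.
rewrite /phi1 (@near_eq_derive1 _ _ (fun y => 0 * y + 0)) ?derive1_affine//.
case: x01 => ->; near=> y; rewrite mul0r addr0; apply: H.
- by left; near: y; exact: lt_nbhsl.
- by right; near: y; exact: lt_nbhsr.
Unshelve. all: by end_near. Qed.

Let affine_FTC (al be a b : R) : a < b ->
  \int[leb]_(x in `[a, b]) ((al + be * x) * phi2 x) =
  ((al + be * b) * phi1 b - be * phi b) - ((al + be * a) * phi1 a - be * phi a).
Proof.
move=> ab.
pose F x := (al + be * x) * phi1 x - be * phi x.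
have dF (x : R) : is_derive x 1 F ((al + be * x) * phi2 x).
  have d1 : is_derive x 1 (fun x : R => al + be * x) be.
    have d1 := @is_deriveD _ _ _ _ _ x 1 _ _ (is_derive_cst al x 1)
      (@is_deriveZ _ _ _ _ be x 1 _ (is_derive_id x 1)).
    by apply: (is_derive_eq d1); rewrite add0r -[_ *: _]/(_ * _) mulr1.
  have d2 := @is_deriveM _ _ _ _ x 1 _ _ d1 (dphi1 x).
  have d3 := @is_deriveB _ _ _ _ _ x 1 _ _ d2 (@is_deriveZ _ _ _ _ be x 1 _ (dphi x)).
  by apply: (is_derive_eq d3); rewrite -![_ *: _]/(_ * _); ring.
have cF : continuous F.
  by move=> x; apply: differentiable_continuous; apply/derivable1_diffP; have [] := dF x.
rewrite /Rintegral (@continuous_FTC2 _ _ F)//.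
- apply: continuous_subspaceT => x; apply: cvgM; last exact: (test_continuous (n := 2)).
  by apply: cvgD; [exact: cvg_cst|apply: cvgMl_tmp; exact: cvg_id].
- split => [x _||]; first by have [] := dF x.
  + by apply: cvg_at_right_filter; exact: cF.
  + by apply: cvg_at_left_filter; exact: cF.
- by move=> x _; rewrite derive1E; apply: derive_val.
Qed.

Lemma affine_test (al be : R) : \int[leb]_(x in I01) ((al + be * x) * phi2 x) = 0.
Proof.
rewrite affine_FTC// !phi1_out ?phi_out; try by [left|right].
by ring.
Qed.

Let phi2_int (w : R -> R) a b : continuous w -> leb.-integrable `[a,
  b] (EFin \o (fun x => w x * phi2 x)).
Proof.
move=> cw; apply: continuous_compact_integrable; first exact: segment_compact.
by apply: continuous_subspaceT => x; apply: cvgM; [exact: cw|exact: (test_continuous (n := 2))].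
Qed.

Lemma green_continuous (y : R) : continuous (fun x : R => green x y).
Proof.
move=> x; apply: cvgB; first exact: cvg_cst.
by apply: (@continuous_max R R^o id (fun=> y) x); [exact: cvg_id|exact: cvg_cst].
Qed.

(** As a function of [x] the kernel is the constant [1 - y] up to [y] and [1 - x] after it. The
    boundary terms in [phi1 y] cancel by continuity of the kernel, and the jump -1 of its slope
    leaves [- phi y]. *)
Lemma green_test y : 0 < y < 1 -> \int[leb]_(x in I01) (green x y * phi2 x) = - phi y.
Proof.
move=> /andP[y0 y1].
have i := @phi2_int (fun x : R => green x y) 0 1 (@green_continuous y).
have i2 : leb.-integrable `]y, 1] (EFin \o (fun x => green x y * phi2 x)).
  apply: integrableS i => // x /=; rewrite !in_itv/= => /andP[yx ->].
  by rewrite andbT; exact: ltW (lt_trans y0 yx).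
have := @Rintegral_itvB _ _ (BLeft 0) (BRight 1) y i.
rewrite !bnd_simp => /(_ (ltW y0) (ltW y1)) /eqP; rewrite subr_eq => /eqP ->.
rewrite (Rintegral_itv_obnd_cbnd i2).
have -> : \int[leb]_(x in `[y, 1]) (green x y * phi2 x) = \int[leb]_(x in `[y,
  1]) ((1 + -1 * x) * phi2 x).
  apply: eq_Rintegral => x; rewrite inE/= in_itv/= => /andP[yx _].
  by rewrite /green max_l// mulN1r.
have -> : \int[leb]_(x in `[0, y]) (green x y * phi2 x) = \int[leb]_(x in `[0,
  y]) (((1 - y) + 0 * x) * phi2 x).
  apply: eq_Rintegral => x; rewrite inE/= in_itv/= => /andP[_ xy].
  by rewrite /green max_r// mul0r addr0.
rewrite !affine_FTC// (phi1_out (x := 0)) ?(phi1_out (x := 1)) ?(phi_out (x :=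
  1)) ?(phi_out (x := 0)); try by [left|right].
by ring.
Qed.

End TestFunction.

(** * The distributional second derivative of a potential *)

Section PotentialDistribution.
Variable R : realType.
Local Notation leb := (@lebesgue_measure R).
Local Notation D01 := (`]0%R, 1%R[%classic : set R).
Local Notation I01 := (`[0%R, 1%R]%classic : set R).
Variable g : R -> R.
Hypotheses (g0 : forall y, 0 <= g y) (mg : measurable_fun setT g)
  (gint : leb.-integrable setT (EFin \o g)) (gout : forall y, ~ D01 y -> g y = 0).

Let mD : measurable D01. Proof. exact: measurable_itv. Qed.

Let gfin : (\int[leb]_y (g y)%:E < +oo)%E.
Proof.
move/integrableP : gint => [_]; apply: le_lt_trans.
by rewrite le_eqVlt; apply/orP; left; apply/eqP; apply: eq_integral => y _; rewrite /= ger0_norm.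
Qed.

Section Test.
Variable phi : R -> R.
Hypothesis tphi : test_fun phi.
Local Notation phi2 := (derive1n 2 phi).

(** The cut to [0, 1] lets Fubini be applied on the whole plane, with an integrand bounded by
    [|w x| g y]. *)
Let w (x : R) : R := phi2 x * \1_I01 x.

Let phi2_measurable : measurable_fun setT phi2.
Proof. by apply: continuous_measurable_fun; exact: (test_continuous tphi (n := 2)). Qed.

Let w_measurable : measurable_fun setT w.
Proof. by apply: measurable_funM => //; exact: measurable_indic. Qed.

Let w_out x : ~ I01 x -> w x = 0.
Proof. by move=> xI; rewrite /w indicE memNset// mulr0. Qed.

Let w_in x : I01 x -> w x = phi2 x.
Proof. by move=> xI; rewrite /w indicE mem_set// mulr1. Qed.

Let phi2_integrable : leb.-integrable I01 (EFin \o phi2).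
Proof.
apply: continuous01_integrable; apply: continuous_subspaceT.
exact: (test_continuous tphi (n := 2)).
Qed.

Let H (p : measurableTypeR R * measurableTypeR R) : \bar R := (w p.1 * green p.1 p.2 * g p.2)%:E.

Let H_measurable : measurable_fun setT H.
Proof.
have m1 : measurable_fun setT (fun p : measurableTypeR R * measurableTypeR R => p.1 :
  R) by exact: measurable_fst.
have m2 : measurable_fun setT (fun p : measurableTypeR R * measurableTypeR R => p.2 :
  R) by exact: measurable_snd.
apply/measurable_EFinP; apply: measurable_funM; last exact: (measurableT_comp mg m2).
apply: measurable_funM; first exact: (measurableT_comp w_measurable m1).
by apply: measurable_funB => //; exact: measurable_maxr.
Qed.

Let H_abs x y : `|w x * green x y * g y| <= `|w x| * g y.
Proof.
rewrite (normrM (w x * green x y)) (normrM (w x)) (ger0_norm (g0 y)).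
have [Dy|Dy] := pselect (D01 y); last by rewrite gout// !mulr0.
have [Ix|Ix] := pselect (I01 x); last by rewrite w_out// normr0 !mul0r.
rewrite ler_wpM2r// -[leRHS]mulr1 ler_wpM2l//.
move: Ix Dy; rewrite /= !in_itv/= => /andP[x0 x1] /andP[y0 y1].
by rewrite ger0_norm ?green_ge0 ?(ltW y1)//; apply: (le_trans (green_le x y)); lra.
Qed.

Let H_integrable : (leb \x leb)%E.-integrable setT H.
Proof.
apply/integrable12ltyP => //.
apply: (@le_lt_trans _ _ (\int[leb]_x (`|w x|%:E * \int[leb]_y (g y)%:E))%E).
  apply: ge0_le_integral => //.
  - by move=> x _; apply: integral_ge0.
  - apply: (measurable_fun_fubini_tonelli_F (m2 := leb) (fun p => `|H p|)%E) => //.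
    exact: measurableT_comp.
  - apply: emeasurable_funM => //; apply/measurable_EFinP; exact: measurableT_comp.
  - move=> x _; rewrite -ge0_integralZl//.
    + apply: ge0_le_integral => //.
      * apply: measurableT_comp => //; apply: (measurableT_comp H_measurable).
        exact: pair1_measurable.
      * by apply: emeasurable_funM => //; exact/measurable_EFinP.
      * by move=> y _; rewrite -EFinM lee_fin; exact: H_abs.
    + exact/measurable_EFinP.
    + by move=> y _; rewrite lee_fin.
have m0 : (0 <= \int[leb]_y (g y)%:E)%E by apply: integral_ge0 => y _; rewrite lee_fin.
rewrite ge0_integralZr//; last by apply/measurable_EFinP; exact: measurableT_comp.
rewrite muleC; apply: lte_mul_pinfty => //; first by rewrite ge0_fin_numE.
rewrite (integral_supp leb (D := I01) (f := fun x => `|w x|)) => [|x Ix];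
  last by rewrite w_out// normr0.
have /integrableP[_] := phi2_integrable; apply: le_lt_trans.
rewrite le_eqVlt; apply/orP; left; apply/eqP.
by apply: eq_integral => x /set_mem Ix; rewrite w_in.
Qed.

Let inner_x y : (\int[leb]_x H (x, y) = (- (phi y * g y))%:E)%E.
Proof.
have [Dy|Dy] := pselect (D01 y); last first.
  rewrite [LHS](_ : _ = \int[leb]_x (cst 0 x))%E; first by rewrite integral0 gout// mulr0 oppr0.
  by apply: eq_integral => x _; rewrite /H /= gout// mulr0.
rewrite [LHS](integral_supp leb (D := I01) (f := fun x => w x * green x y * g y)) => [|x Ix];
  last by rewrite w_out// !mul0r.
have i : leb.-integrable I01 (EFin \o (fun x => green x y * phi2 x)).
  apply: continuous01_integrable; apply: continuous_subspaceT => x; apply: cvgM.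
    exact: green_continuous.
  exact: (test_continuous tphi (n := 2)).
transitivity ((g y)%:E * \int[leb]_(x in I01) (green x y * phi2 x)%:E)%E.
  rewrite -integralZl//; apply: eq_integral => x /set_mem Ix.
  by rewrite -EFinM w_in//; congr EFin; ring.
have fin : (\int[leb]_(x in I01) (green x y * phi2 x)%:E)%E \is a fin_num.
  by apply: integrable_fin_num.
rewrite -(fineK fin) -EFinM.
move: (Dy); rewrite /= in_itv/= => /(green_test tphi); rewrite /Rintegral => ->.
by congr EFin; ring.
Qed.

Lemma test_mul_integrable : leb.-integrable setT (EFin \o (fun y => phi y * g y)).
Proof.
have [M [Mr HM]] : bounded_set (phi @` I01).
  apply: compact_bounded; apply: continuous_compact; last exact: segment_compact.
  by apply: continuous_subspaceT; exact: (test_continuous tphi (n := 0)).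
have i : leb.-integrable setT (EFin \o (fun y => (M + 1) * g y)).
  rewrite (_ : EFin \o _ = (fun y => (M + 1)%:E * (EFin \o g) y)%E)//.
  exact: integrableZl.
apply: le_integrable i => //.
  apply/measurable_EFinP; apply: measurable_funM => //.
  by apply: continuous_measurable_fun; exact: (test_continuous tphi (n := 0)).
move=> y _; rewrite /= lee_fin !normrM.
have [Dy|Dy] := pselect (D01 y); last by rewrite gout// normr0 !mulr0.
rewrite ler_wpM2r//; apply: le_trans (ler_norm _).
apply: (HM (M + 1)); first by rewrite ltrDl.
by exists y => //; move: Dy; rewrite /= !in_itv/= => /andP[/ltW -> /ltW ->].
Qed.

(** Exchanging the integrals leaves, for each [y], the pairing of [green _ y] with [phi2], which is
    [green_test]. *)
Lemma potential_test :
  \int[leb]_(x in I01) (phi2 x * potential g x) = - \int[leb]_(y in D01) (phi y * g y).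
Proof.
have := Fubini H_integrable.
have -> : (\int[leb]_x \int[leb]_y H (x, y) = (\int[leb]_(x in I01) (phi2 x * potential g x))%:E)%E.
  have E x : (\int[leb]_y H (x, y) = (w x * potential g x)%:E)%E.
    rewrite [LHS](integral_supp leb (D := D01) (f :=
      fun y => w x * green x y * g y)) => [|y Dy]; last by rewrite gout// mulr0.
    transitivity ((w x)%:E * \int[leb]_(y in D01) (green x y * g y)%:E)%E.
      rewrite -integralZl//; last exact: green_mul_integrable.
      by apply: eq_integral => y _; rewrite -EFinM mulrA.
    rewrite [RHS]EFinM; congr (_ * _)%E; rewrite /potential /Rintegral fineK//.
    by apply: integrable_fin_num => //; exact: green_mul_integrable.
  under eq_integral do rewrite E.
  rewrite (integral_supp leb (D := I01) (f := fun x => w x * potential g x)) => [|x Ix];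
    last by rewrite w_out// mul0r.
  rewrite /Rintegral fineK.
    by apply: eq_integral => x /set_mem Ix; rewrite w_in.
  apply: integrable_fin_num => //.
  apply: continuous01_integrable; apply: continuous_subspaceT => x; apply: cvgM.
    exact: (test_continuous tphi (n := 2)).
  exact: potential_continuous.
under eq_integral do rewrite inner_x.
rewrite (integral_supp leb (D := D01) (f := fun y => - (phi y * g y))) => [|y Dy]; last first.
  by rewrite gout// mulr0 oppr0.
have pD : leb.-integrable D01 (EFin \o (fun y => phi y * g y)).
  by apply: integrableS test_mul_integrable.
have : (\int[leb]_(y in D01) (phi y * g y)%:E)%E \is a fin_num by exact: integrable_fin_num.
move=> fin; under eq_integral do rewrite EFinN.
rewrite integralN; last first.
  by apply: (integrable_add_def _ pD).
by rewrite -(fineK fin) => -[].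
Qed.

End Test.

Lemma second_dist_deriv_potential (al be : R) :
  second_dist_deriv (fun x => al + be * x - potential g x) (density_measure (lebR R) g0 mg).
Proof.
have gE A : measurable A -> density_measure (lebR R) g0 mg A = (\int[leb]_(y in A) (g y)%:E)%E.
  move=> mA; rewrite /density_measure ge0_integral_lebR//.
  - by apply/measurable_EFinP; exact: measurable_funTS.
  - by move=> y _; rewrite lee_fin.
split; [|split].
- rewrite /= gE; last exact: measurableC.
  transitivity (\int[leb]_(y in ~` D01) (cst 0 y))%E; last exact: integral0.
  by apply: eq_integral => y; rewrite inE => Dy; rewrite gout.
- move=> a c _ _; rewrite /= gE//; apply: le_lt_trans gfin.
  apply: ge0_subset_integral => //; first exact/measurable_EFinP.
  by move=> y _; rewrite lee_fin.
- move=> phi tphi.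
  have pint := test_mul_integrable tphi.
  have cphi : continuous phi := test_continuous tphi (n := 0).
  have mphi : measurable_fun setT phi by exact: continuous_measurable_fun.
  have cphi2 : continuous (derive1n 2 phi) := test_continuous tphi (n := 2).
  have i1 : leb.-integrable I01 (EFin \o (fun x => (al + be * x) * derive1n 2 phi x)).
    apply: continuous01_integrable; apply: continuous_subspaceT => x; apply: cvgM => //;
      last exact: cphi2.
    by apply: cvgD; [exact: cvg_cst|apply: cvgMl_tmp; exact: cvg_id].
  have i2 : leb.-integrable I01 (EFin \o (fun x => derive1n 2 phi x * potential g x)).
    apply: continuous01_integrable; apply: continuous_subspaceT => x; apply: cvgM; first exact:
      cphi2.
    exact: potential_continuous.
  transitivity ((\int[leb]_(y in D01) (phi y * g y))%:E).
    have -> : \int[leb]_(y in D01) (phi y * g y) =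
        \int[leb]_(x in I01) ((al + be * x) * derive1n 2 phi x - derive1n 2 phi x * potential g x).
      by rewrite RintegralB// affine_test// potential_test// sub0r opprK.
    rewrite /Rintegral fineK; last first.
      apply: integrable_fin_num => //.
      rewrite (_ : (fun x => _) = ((EFin \o (fun x => (al + be * x) * derive1n 2 phi x)%R) \-
        (EFin \o (fun x => derive1n 2 phi x * potential g x)%R))%E)//.
      exact: integrableB.
    by apply: eq_integral => x _; congr EFin; ring.
  (* [ge0_integral_density] covers nonnegative functions only, so [phi] is split into its positive
     and negative parts. *)
  pose pp y := Num.max (phi y) 0; pose pn y := Num.max (- phi y) 0.
  have pp0 y : 0 <= pp y by rewrite le_max lexx orbT.
  have pn0 y : 0 <= pn y by rewrite le_max lexx orbT.
  have mpp : measurable_fun setT pp by exact: measurable_maxr.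
  have mpn : measurable_fun setT pn by apply: measurable_maxr => //; exact: measurableT_comp.
  have E (q : R -> R) : (forall y, 0 <= q y) -> measurable_fun setT q ->
    (\int[density_measure (lebR R) g0 mg]_y (q y)%:E = \int[leb]_y (q y * g y)%:E)%E.
    move=> q0 mq; rewrite ge0_integral_density// ge0_integral_lebR//.
    - by apply/measurable_EFinP; exact: measurable_funM.
    - by move=> y _; rewrite lee_fin mulr_ge0.
  have int (q : R -> R) : measurable_fun setT q -> (forall y, `|q y| <= `|phi y|) ->
    leb.-integrable setT (EFin \o (fun y => q y * g y)).
    move=> mq qphi; apply: le_integrable pint => //.
      by apply/measurable_EFinP; exact: measurable_funM.
    by move=> y _; rewrite /= lee_fin !normrM ler_wpM2r.
  rewrite [RHS]integralE.
  rewrite (_ : (fun y => (phi y)%:E)^\+%E = (fun y => (pp y)%:E)); last first.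
    by apply/funext => y; rewrite funeposE -EFin_max.
  rewrite (_ : (fun y => (phi y)%:E)^\-%E = (fun y => (pn y)%:E)); last first.
    by apply/funext => y; rewrite funenegE -EFinN -EFin_max.
  rewrite !E// -integralB_EFin//; last 2 first.
  + apply: int => // y; rewrite (ger0_norm (pp0 y)) /pp ge_max ler_norm.
    by rewrite normr_ge0.
  + apply: int => // y; rewrite (ger0_norm (pn0 y)) /pn ge_max -normrN ler_norm.
    by rewrite normr_ge0.
  have -> : (\int[leb]_(y in D01) (phi y * g y))%:E = (\int[leb]_y (phi y * g y)%:E)%E.
    rewrite (integral_supp leb (D := D01) (f := fun y => phi y * g y)) => [|y Dy]; last first.
      by rewrite gout// mulr0.
    by rewrite /Rintegral fineK//; apply: integrable_fin_num => //; exact: integrableS pint.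
  apply: eq_integral => y _; rewrite -EFinB -mulrBl; congr ((_ * _)%:E).
  rewrite /pp /pn; have [h|h] := leP (phi y) 0.
    by rewrite max_l ?oppr_ge0//; lra.
  by rewrite max_r ?subr0// oppr_le0 ltW.
Qed.

End PotentialDistribution.

(** * Reduction to densities *)

Section Reduction.
Variables (R : realType) (b : nat -> R) (h : R).
Hypothesis Hb : is_model b.
Local Notation leb := (@lebesgue_measure R).
Local Notation D01 := (`]0%R, 1%R[%classic : set R).
Local Notation I01 := (`[0%R, 1%R]%classic : set R).
Local Notation xi := (model_xi b).

Let mD : measurable D01. Proof. exact: measurable_itv. Qed.

(** The right-hand side of [green_representation] for slope [- h ^+ 2] and end value [xi 1], with
    [eta x] replaced by its lower bound [xi x]. *)
Definition budget (x : R) : R := xi 1 - xi x + h ^+ 2 * (1 - x).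

Lemma budget_le : exists M : R, forall x, 0 < x < 1 -> budget x <= M * (1 - x).
Proof.
have [L L0 HL] := model_xi_lipschitz1 Hb.
exists (L + h ^+ 2) => x /andP[x0 x1]; rewrite mulrDl lerD2r; apply: HL.
by rewrite !ltW.
Qed.

Lemma green_ge (x y : R) : 0 <= x <= 1 -> 0 <= y <= 1 -> (1 - x) * (1 - y) <= green x y.
Proof.
move=> /andP[x0 x1] /andP[y0 y1]; rewrite /green.
by have [xy|yx] := leP x y; nra.
Qed.

Lemma integral_green_cst (x e : R) : 0 < x < 1 -> 0 <= e ->
  (\int[leb]_(y in D01) (green x y * e)%:E <= (e * (1 - x))%:E)%E.
Proof.
move=> /andP[x0 x1] e0.
apply: (@le_trans _ _ (\int[leb]_(y in D01) (cst (e * (1 - x))%:E y))%E).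
  apply: ge0_le_integral => //.
  - move=> y /=; rewrite in_itv/= => /andP[_ y1].
    by rewrite lee_fin mulr_ge0// green_ge0// ltW.
  - apply/measurable_EFinP; apply: measurable_funM => //; apply: measurable_funTS; exact:
    measurable_green.
  - by move=> y _; rewrite lee_fin mulrC ler_wpM2l// green_le.
rewrite integral_cst//= lebesgue_measure_itv/= lte_fin ltr01.
by rewrite -EFinB subr0 mule1.
Qed.

(** As [green x] is at most [1 - x] and ]0, 1[ has length 1, a constant density [e] costs at most
    [e (1 - x)] of the budget. *)
Lemma feasible_add_cst (C : R -> R) (g : R -> R) (e : R) : 0 <= e ->
  (forall y, 0 <= g y) -> measurable_fun setT g ->
  (forall x, 0 < x < 1 -> (\int[leb]_(y in D01) (green x y * g y)%:E + (e * (1 - x))%:E <=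
    (C x)%:E)%E) ->
  feasible C (fun y => g y + e).
Proof.
move=> e0 g0 mg HC; split.
- by move=> y; rewrite addr_ge0.
- exact: measurable_funD.
- move=> x x01; have /andP[x0 x1] := x01.
  apply: le_trans (HC x x01).
  have gr y : D01 y -> 0 <= green x y.
    by rewrite /= in_itv/= => /andP[_ y1]; rewrite green_ge0// ltW.
  have -> : (\int[leb]_(y in D01) (green x y * (g y + e))%:E =
    \int[leb]_(y in D01) (green x y * g y)%:E + \int[leb]_(y in D01) (green x y * e)%:E)%E.
    rewrite -ge0_integralD//.
    + by apply: eq_integral => y _; rewrite -EFinD mulrDr.
    + by move=> y Dy; rewrite lee_fin mulr_ge0// gr.
    + by apply/measurable_EFinP; apply: measurable_funTS; exact: measurable_green_mul.
    + by move=> y Dy; rewrite lee_fin mulr_ge0// gr.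
    + by apply/measurable_EFinP; apply: measurable_funTS; exact: measurable_green_mul.
  by rewrite leeD2l// integral_green_cst.
Qed.

Lemma feasible_cst : exists2 c : R, 0 < c & feasible budget (fun=> c).
Proof.
have [c c0 Hc] := model_xi_gap Hb.
exists c => //.
have -> : (fun=> c) = (fun y : R => (fun=> 0) y + c) by apply/funext => y; rewrite add0r.
apply: feasible_add_cst => //; first exact: ltW.
move=> x /andP[x0 x1].
have -> : (\int[leb]_(y in D01) (green x y * 0)%:E = 0)%E.
  by under eq_integral do rewrite mulr0; rewrite integral0.
rewrite add0e lee_fin /budget; have : c * (1 - x) <= xi 1 - xi x by apply: Hc; rewrite !ltW.
have : 0 <= h ^+ 2 * (1 - x) by rewrite mulr_ge0 ?sqr_ge0//; lra.
lra.
Qed.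

(** [green_representation] with the measure split into its density and [nu]; singularity of [nu]
    does not enter. *)
Lemma ac_representation eta (mu nu : {measure set R -> \bar R}) (g : R -> R) : K_class b h eta ->
  second_dist_deriv eta mu -> (forall x, 0 <= g x) -> measurable_fun setT g ->
  (forall A : set R, measurable A -> mu A = (\int[leb]_(x in A) (g x)%:E + nu A)%E) ->
  forall x, 0 < x < 1 ->
  (\int[leb]_(y in D01) (green x y * g y)%:E + \int[nu]_(y in D01) (green x y)%:E =
   (xi 1 + h ^+ 2 * (1 - x) - eta x)%:E)%E.
Proof.
move=> [ceta [_ [_ [eta1 deta]]]] dmu g0 mg Hmu x x01; have /andP[x0 x1] := x01.
rewrite derive1_model_xi0// sub0r in deta.
have := green_representation ceta dmu deta x01.
rewrite eta1 mulNr opprK => <-.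
(* The kernel is negative beyond 1, and [ge0_integral_density_add] asks for a function nonnegative
   everywhere. *)
pose k y := Num.max (green x y) 0.
have k0 y : 0 <= k y by rewrite le_max lexx orbT.
have mk : measurable_fun setT k by apply: measurable_maxr => //; exact: measurable_green.
have kE y : D01 y -> k y = green x y.
  by rewrite /= in_itv/= => /andP[_ y1]; rewrite /k max_l// green_ge0// ltW.
have Hmu' A : measurable A -> mu A = (\int[lebR R]_(y in A) (g y)%:E + nu A)%E.
  move=> mA; rewrite Hmu// ge0_integral_lebR//.
  - by apply/measurable_EFinP; exact: measurable_funTS.
  - by move=> y _; rewrite lee_fin.
have := ge0_integral_density_add g0 mg Hmu' k0 mk mD.
rewrite ge0_integral_lebR//.
- move=> E.
  transitivity (\int[mu]_(y in D01) (k y)%:E)%E; last first.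
    by apply: eq_integral => y /set_mem Dy; rewrite kE.
  rewrite E; congr (_ + _)%E; apply: eq_integral => y /set_mem Dy; by rewrite kE.
- by apply/measurable_EFinP; apply: measurable_funTS; exact: measurable_funM.
- by move=> y _; rewrite lee_fin mulr_ge0.
Qed.

Lemma integral_green_ge0 (nu : {measure set R -> \bar R}) x : 0 < x < 1 ->
  (0 <= \int[nu]_(y in D01) (green x y)%:E)%E.
Proof.
move=> /andP[_ x1]; apply: integral_ge0 => y; rewrite /= in_itv/= => /andP[_ y1].
by rewrite lee_fin green_ge0// ltW.
Qed.

Lemma decomposition_feasible eta (mu nu : {measure set R -> \bar R}) (g : R -> R) :
  K_class b h eta ->
  second_dist_deriv eta mu -> (forall x, 0 <= g x) -> measurable_fun setT g ->
  (forall A : set R, measurable A -> mu A = (\int[leb]_(x in A) (g x)%:E + nu A)%E) ->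
  feasible budget g.
Proof.
move=> Keta dmu g0 mg Hmu; split => // x x01.
have n0 := integral_green_ge0 nu x01.
apply: (@le_trans _ _ (xi 1 + h ^+ 2 * (1 - x) - eta x)%:E).
  by rewrite -(ac_representation Keta dmu g0 mg Hmu x01) leeDl.
rewrite lee_fin /budget; move: Keta => [_ [_ [xi_eta _]]].
have : xi x <= eta x by apply: xi_eta; move: x01; rewrite in_itv/= => /andP[/ltW -> /ltW ->].
lra.
Qed.

Lemma ac_density_feasible eta g : K_class b h eta -> ac_density eta g -> feasible budget g.
Proof.
move=> Keta [mu [nu [dmu [_ [g0 [mg Hmu]]]]]].
exact: (decomposition_feasible Keta dmu g0 mg Hmu).
Qed.

(* If the singular part were nonzero, trading it for a small constant density would
   keep [feasible] and strictly increase [sqrt_mass]. *)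
Lemma maximal_singular0 eta (mu nu : {measure set R -> \bar R}) (g : R -> R) : K_class b h eta ->
  second_dist_deriv eta mu -> (forall x, 0 <= g x) -> measurable_fun setT g ->
  (forall A : set R, measurable A -> mu A = (\int[leb]_(x in A) (g x)%:E + nu A)%E) ->
  sqrt_mass g = sqrt_mass_sup budget ->
  forall x, 0 < x < 1 -> (\int[nu]_(y in D01) (green x y)%:E = 0)%E.
Proof.
move=> Keta dmu g0 mg Hmu gmax.
have [M HM] := budget_le.
have rep := ac_representation Keta dmu g0 mg Hmu.
have mone : measurable_fun D01 (fun y : R => (1 - y)%:E).
  by apply/measurable_EFinP; exact: measurable_funB.
have one0 y : D01 y -> (0 <= (1 - y)%:E)%E.
  by rewrite /= in_itv/= => /andP[_ y1]; rewrite lee_fin subr_ge0 ltW.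
have mgr x : measurable_fun D01 (fun y => (green x y)%:E).
  by apply/measurable_EFinP; apply: measurable_funTS; exact: measurable_green.
(* The weight [1 - y] dominates every [green x y], and up to the factor [1 - x] it also bounds
   [green x y] from below, so one number controls all [x] at once. *)
suff nu1 : (\int[nu]_(y in D01) (1 - y)%:E = 0)%E.
  move=> x x01; apply/eqP; rewrite eq_le integral_green_ge0// andbT -nu1.
  apply: ge0_le_integral => //.
  - move=> y; rewrite /= in_itv/= => /andP[_ y1]; move: x01 => /andP[_ x1].
    by rewrite lee_fin green_ge0// ltW.
  - by move=> y _; rewrite lee_fin greenC green_le.
apply/eqP; rewrite eq_le [X in _ && X]integral_ge0// andbT leNgt; apply/negP => nupos.
(* The integral is an extended real: if it is finite, [e] is its value; if it is infinite, [e] is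
   1. *)
have [e e0 enu] : exists2 e : R, 0 < e & (e%:E <= \int[nu]_(y in D01) (1 - y)%:E)%E.
  move: nupos; case: (\int[nu]_(y in D01) (1 - y)%:E)%E => [r r0|_|//].
    by exists r.
  by exists 1; rewrite // leey.
have fe : feasible budget (fun y => g y + e).
  apply: feasible_add_cst => //; first exact: ltW.
  move=> x x01; have /andP[x0 x1] := x01.
  apply: (@le_trans _ _ (xi 1 + h ^+ 2 * (1 - x) - eta x)%:E); last first.
    rewrite lee_fin /budget; move: Keta => [_ [_ [xi_eta _]]].
    have : xi x <= eta x by apply: xi_eta; rewrite in_itv/= !ltW.
    lra.
  rewrite -rep// leeD2l//.
  apply: (@le_trans _ _ ((1 - x)%:E * \int[nu]_(y in D01) (1 - y)%:E)%E).
    by rewrite EFinM muleC lee_pmul2l// lte_fin subr_gt0.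
  rewrite -ge0_integralZl//; last by rewrite lee_fin subr_ge0 ltW.
  apply: ge0_le_integral => //.
  - by move=> y Dy; apply: mule_ge0; [rewrite lee_fin subr_ge0 ltW|exact: one0].
  - exact: emeasurable_funM.
  - move=> y; rewrite /= in_itv/= => /andP[y0 y1].
    by rewrite -EFinM lee_fin green_ge// !ltW.
have fg : feasible budget g := decomposition_feasible Keta dmu g0 mg Hmu.
have gle : sqrt_mass g <= sqrt_mass (fun y => g y + e).
  apply: le_Rintegral => //; [exact: (sqrt_integrable HM)..|].
  by move=> y _; rewrite ler_wsqrtr// lerDl ltW.
(* Strict increase is obtained from uniqueness: [g + e] would be a second maximizer, hence equal to
   [g] almost everywhere on an interval of measure 1. *)
have emax : sqrt_mass (fun y => g y + e) = sqrt_mass_sup budget.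
  by apply/eqP; rewrite eq_le (sqrt_mass_le_sup HM)//= -gmax.
have := maximizer_unique HM fg fe gmax emax.
move=> [N [mN N0 sub]].
have : (leb D01 <= leb N)%E.
  apply: le_measure; rewrite ?inE//.
  move=> y Dy; apply: sub => /= H; have := H Dy => -[].
  by move=> /eqP; rewrite -subr_eq0 opprD addNKr oppr_eq0 gt_eqF.
rewrite N0 lebesgue_measure_itv/= lte_fin ltr01 -EFinB lee_fin; lra.
Qed.

End Reduction.

(** * The optimal function and the densities of its second derivative *)

Section Optimum.
Variables (R : realType) (b : nat -> R) (h : R).
Hypothesis Hb : is_model b.
Local Notation leb := (@lebesgue_measure R).
Local Notation D01 := (`]0%R, 1%R[%classic : set R).
Local Notation I01 := (`[0%R, 1%R]%classic : set R).
Local Notation xi := (model_xi b).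
Local Notation bud := (@budget R b h).

Let mD : measurable D01. Proof. exact: measurable_itv. Qed.

Lemma optimal_density : exists g : R -> R, [/\ feasible bud g,
  sqrt_mass g = sqrt_mass_sup bud, leb.-integrable setT (EFin \o g) &
  forall y, ~ D01 y -> g y = 0].
Proof.
have [M HM] := budget_le h Hb.
have [c _ fc] := feasible_cst h Hb.
have [f ff fmax] := maximizer_exists HM (ex_intro _ _ fc).
(* Feasibility and [sqrt_mass] see [f] on ]0, 1[ only; the cut makes it integrable on the line and
   zero outside, as the potential lemmas require. *)
pose g y := f y * \1_D01 y.
have gin y : D01 y -> g y = f y by move=> Dy; rewrite /g indicE mem_set// mulr1.
have gout y : ~ D01 y -> g y = 0 by move=> Dy; rewrite /g indicE memNset// mulr0.
exists g; have [f0 mf fC] := ff; split => //.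
- split.
  + by move=> y; rewrite mulr_ge0.
  + by apply: measurable_funM => //; exact: measurable_indic.
  + move=> x x01; apply: le_trans (fC x x01); rewrite le_eqVlt; apply/orP; left; apply/eqP.
    by apply: eq_integral => y /set_mem Dy; rewrite gin.
- by rewrite -fmax; apply: eq_Rintegral => y /set_mem Dy; rewrite gin.
- have := feasible_integrable HM ff.
  rewrite -[X in leb.-integrable X _ -> _](setTI D01) => /(integrable_restrict leb mD measurableT).
  apply: eq_integrable => // y _; rewrite patchE /=.
  have [Dy|Dy] := pselect (D01 y); first by rewrite mem_set// gin.
  by rewrite memNset// gout.
Qed.

Section Candidate.
Variable g : R -> R.
Hypotheses (fg : feasible bud g) (gmax : sqrt_mass g = sqrt_mass_sup bud)
  (gint : leb.-integrable setT (EFin \o g)) (gout : forall y, ~ D01 y -> g y = 0).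

Let g0 : forall y, 0 <= g y. Proof. by case: fg. Qed.
Let mg : measurable_fun setT g. Proof. by case: fg. Qed.

(** [ac_representation] solved for [eta], without a singular part. *)
Definition optimum (x : R) : R := (xi 1 + h ^+ 2) + (- h ^+ 2) * x - potential g x.

Let potential_fin x : (\int[leb]_(y in D01) (green x y * g y)%:E)%E = (potential g x)%:E.
Proof.
rewrite /potential /Rintegral fineK//; apply: integrable_fin_num => //.
exact: green_mul_integrable.
Qed.

Let potential_le x : 0 < x < 1 -> potential g x <= bud x.
Proof. by move=> x01; rewrite -lee_fin -potential_fin; case: fg => _ _; apply. Qed.

Lemma optimum_K : K_class b h optimum.
Proof.
split; [|split; [|split; [|split]]].
- apply: continuous_subspaceT => x; apply: cvgB; last exact: potential_continuous.
  by apply: cvgD; [exact: cvg_cst|apply: cvgMl_tmp; exact: cvg_id].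
- move=> x y t _ _; rewrite in_itv/= => t01; rewrite /optimum.
  have := potential_concave g0 mg gint x y t01; lra.
- move=> x; rewrite in_itv/= => /andP[]; rewrite le_eqVlt => /predU1P[<- _|x0].
    rewrite /optimum model_xi0// mulr0 addr0 subr_ge0.
    (* Feasibility speaks of the open interval only, so the inequality at 0 is a limit from the
       right. *)
    have pc : (fun t => potential g t) @ 0^'+ --> potential g 0.
      by apply: cvg_at_right_filter; exact: potential_continuous.
    apply: (cvgr_to_le pc); near=> t.
    have t01 : 0 < t < 1.
      by apply/andP; split; near: t; [exact: nbhs_right_gt|exact: nbhs_right_lt].
    apply: (le_trans (potential_le t01)); rewrite /budget.
    have : 0 <= xi t by apply: (model_xi_ge0 Hb); move: t01 => /andP[/ltW -> /ltW ->].
    have : 0 <= h ^+ 2 * t by rewrite mulr_ge0 ?sqr_ge0//; move: t01 => /andP[/ltW].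
    lra.
  rewrite le_eqVlt => /predU1P[->|x1].
    by rewrite /optimum potential1; lra.
  have := potential_le (x := x); rewrite x0 x1 => /(_ isT); rewrite /optimum /budget; lra.
- by rewrite /optimum potential1; lra.
- rewrite derive1_model_xi0// sub0r.
  have S := potential_slope0 g0 mg gint.
  rewrite -[X in _ --> X]addr0.
  have C : (fun t : R => - h ^+ 2 + (potential g 0 - potential g t) / t) @ 0^'+ --> - h ^+ 2 + 0.
    by apply: cvgD; [exact: cvg_cst|exact: S].
  apply: cvg_trans C; apply: near_eq_cvg; near=> t.
  have t0 : 0 < t by near: t; exact: nbhs_right_gt.
  by rewrite /optimum; field; rewrite gt_eqF.
Unshelve. all: by end_near. Qed.

Let dmu : second_dist_deriv optimum (density_measure (lebR R) g0 mg).
Proof. exact: second_dist_deriv_potential. Qed.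

Lemma optimum_ac : ac_density optimum g.
Proof.
exists (density_measure (lebR R) g0 mg), mzero; split => //; split.
  by exists set0; split => //; split => //; exact: measure0.
split => //; split => // A mA; rewrite /mzero adde0.
rewrite /= /density_measure ge0_integral_lebR//.
- by apply/measurable_EFinP; exact: measurable_funTS.
- by move=> y _; rewrite lee_fin.
Qed.

(** [D] is computed from whichever density [eta2_ac] selects, together with an unknown measure and
    singular part. By [green_determines] the measure is the one of density [g]; off the null set
    carrying [nu], the two densities then have equal integrals on all measurable sets. *)
Lemma optimum_ac_unique g' : ac_density optimum g' -> sqrt_mass g' = sqrt_mass g.
Proof.
move=> [mu [nu [dmu' [[N [mN [N0 nuN]]] [g'0 [mg' Hmu]]]]]].
pose dm : {measure set R -> \bar R} := density_measure (lebR R) g0 mg.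
have dmE A : measurable A -> dm A = (\int[leb]_(y in A) (g y)%:E)%E.
  move=> mA; rewrite /dm/= /density_measure ge0_integral_lebR//.
  - by apply/measurable_EFinP; exact: measurable_funTS.
  - by move=> y _; rewrite lee_fin.
have [copt [_ [_ [opt1 dopt]]]] := optimum_K.
have rep m : second_dist_deriv optimum m -> forall z, 0 < z < 1 -> _ :=
  fun dm z z01 => green_representation copt dm dopt z01.
have E A : measurable A -> dm A = mu A.
  apply: green_determines.
  - exact: (proj1 dmu).
  - exact: (proj1 dmu').
  - rewrite dmE//.
    move/integrableP : gint => [_]; apply: le_lt_trans.
    apply: (@le_trans _ _ (\int[leb]_y (g y)%:E)%E).
      apply: ge0_subset_integral => //; first exact/measurable_EFinP.
      by move=> y _; rewrite lee_fin.
    rewrite le_eqVlt; apply/orP; left; apply/eqP; apply: eq_integral => y _.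
    by rewrite /= ger0_norm.
  - by move=> z z01; rewrite (rep _ dmu) // (rep _ dmu').
  - by move=> z z01; rewrite (rep _ dmu)// ltry.
pose E0 := D01 `\` N.
have mE0 : measurable E0 by exact: measurableD.
have ae : ae_eq leb E0 (EFin \o g) (EFin \o g').
  apply: integral_ae_eq => //.
  - exact: integrableS gint.
  - by apply/measurable_EFinP; exact: measurable_funTS.
  - move=> A AE0 mA; rewrite /= -dmE// E// Hmu//.
    suff -> : nu A = 0%E by rewrite adde0.
    apply: (subset_measure0 _ _ _ nuN) => //; first exact: measurableC.
    by move=> y /AE0[].
have ms (k : R -> R) : measurable_fun setT k -> measurable_fun D01 (fun y => (Num.sqrt (k y))%:E).
  by move=> mk; apply/measurable_EFinP; apply: measurable_funTS; exact: measurable_sqrtr.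
rewrite /sqrt_mass /Rintegral; congr fine.
have negl (k : R -> R) : measurable_fun setT k ->
  (\int[leb]_(y in D01) (Num.sqrt (k y))%:E = \int[leb]_(y in E0) (Num.sqrt (k y))%:E)%E.
  move=> mk; apply: ge0_negligible_integral => //; exact: ms.
rewrite !negl//.
have mS (k : R -> R) : measurable_fun setT k -> measurable_fun E0 (fun y => (Num.sqrt (k y))%:E).
  by move=> mk; apply: measurable_funS (ms k mk) => // y [].
apply: ae_eq_integral => //; [exact: mS|exact: mS|].
by apply: filterS ae => y H Ey; have := H Ey => -[->].
Qed.

End Candidate.
End Optimum.

(** * Evaluation of [D], attainment and uniqueness *)

Lemma DfunE (R : realType) (eta : R -> R) (C : R -> R) (M : R) :
  (forall x, 0 < x < 1 -> C x <= M * (1 - x)) -> feasible C (eta2_ac eta) ->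
  Dfun eta = (2 * sqrt_mass (eta2_ac eta))%:E.
Proof.
move=> HM fe; have [_ me _] := fe.
rewrite /Dfun EFinM; congr (_ * _)%E.
rewrite integral_itv_bndoo.
  rewrite /sqrt_mass /Rintegral fineK//.
  by apply: integrable_fin_num => //; exact: (sqrt_integrable HM fe).
by apply/measurable_EFinP; apply: measurable_funTS; exact: measurable_sqrtr.
Qed.

(* [eta2_ac] then takes the default value of [xget]. *)
Lemma Dfun_no_density (R : realType) (eta : R -> R) :
  (forall g, ~ ac_density eta g) -> Dfun eta = 0%E.
Proof.
move=> nog; rewrite /Dfun /eta2_ac xgetPN//.
by under eq_integral do rewrite sqrtr0; rewrite integral0 mule0.
Qed.

Theorem theorem3p6 (R : realType) (b : nat -> R) (h : R) :
  is_model b -> 0 <= h ->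
  exists eta0 : R -> R,
    K_class b h eta0 /\
    Dfun eta0 = ereal_sup [set Dfun eta | eta in K_class b h] /\
    (forall eta : R -> R, K_class b h eta ->
       Dfun eta = ereal_sup [set Dfun e | e in K_class b h] ->
       forall x, x \in `[0, 1] -> eta x = eta0 x).
Proof.
move=> Hb _.
have [M HM] := budget_le h Hb.
have [g [fg gmax gint gout]] := optimal_density h Hb.
have [g0 mg gC] := fg.
have eta0K := optimum_K Hb fg gint.
have [c c0 fc] := feasible_cst h Hb.
(* Strict positivity is what later excludes a maximizer without a density, for which [D] is 0. *)
have s0 : 0 < sqrt_mass_sup (budget b h).
  apply: lt_le_trans (sqrt_mass_le_sup HM fc).
  rewrite /sqrt_mass Rintegral_cst//= lebesgue_measure_itv/= lte_fin ltr01 -EFinB/=.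
  by rewrite subr0 mulr1 sqrtr_gt0.
have Dle eta : K_class b h eta -> (Dfun eta <= (2 * sqrt_mass_sup (budget b h))%:E)%E.
  move=> Keta; have [[g' dg']|nog] := pselect (exists g', ac_density eta g'); last first.
    rewrite Dfun_no_density; last by move=> g' dg'; apply: nog; exists g'.
    by rewrite lee_fin mulr_ge0// ltW.
  have dg : ac_density eta (eta2_ac eta) := xgetPex _ (ex_intro _ g' dg').
  have fe := ac_density_feasible Hb Keta dg.
  by rewrite (DfunE HM fe) lee_fin ler_wpM2l// (sqrt_mass_le_sup HM fe).
have D0 : Dfun (optimum b h g) = (2 * sqrt_mass_sup (budget b h))%:E.
  have dg : ac_density (optimum b h g) (eta2_ac (optimum b h g)) :=
    xgetPex _ (ex_intro _ g (optimum_ac fg gint gout)).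
  have fe := ac_density_feasible Hb eta0K dg.
  rewrite (DfunE HM fe) -gmax; congr ((_ * _)%:E).
  exact: (optimum_ac_unique Hb fg gint gout dg).
have Dsup : ereal_sup [set Dfun eta | eta in K_class b h] = (2 * sqrt_mass_sup (budget b h))%:E.
  apply/eqP; rewrite eq_le; apply/andP; split.
    by apply: ge_ereal_sup => _ [eta Keta <-]; exact: Dle.
  by rewrite -D0; apply: ereal_sup_ubound; exists (optimum b h g).
exists (optimum b h g); split => //; split; first by rewrite D0 Dsup.
move=> eta Keta; rewrite Dsup => Deta.
have [[g' dg']|nog] := pselect (exists g', ac_density eta g'); last first.
  move: Deta; rewrite Dfun_no_density; last by move=> g' dg'; apply: nog; exists g'.
  by move=> [] /esym/eqP; rewrite mulf_eq0 pnatr_eq0/= gt_eqF.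
have dg : ac_density eta (eta2_ac eta) := xgetPex _ (ex_intro _ g' dg').
have fe := ac_density_feasible Hb Keta dg.
have emax : sqrt_mass (eta2_ac eta) = sqrt_mass_sup (budget b h).
  by move: Deta; rewrite (DfunE HM fe) => -[] /(mulfI _); apply; rewrite pnatr_eq0.
have [mu [nu [dmu [_ [e0 [me Hmu]]]]]] := dg.
have nu0 := maximal_singular0 Hb Keta dmu e0 me Hmu emax.
have rep := ac_representation Hb Keta dmu e0 me Hmu.
have ae := maximizer_unique HM fe fg emax gmax.
(* With no contribution of [nu] and densities equal almost everywhere, both functions have the same
   Green representation. *)
have inner x : 0 < x < 1 -> eta x = optimum b h g x.
  move=> x01; have := rep x x01; rewrite nu0// adde0.
  have -> : (\int[lebesgue_measure]_(y in `]0%R, 1%R[) (green x y * eta2_ac eta y)%:E =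
      (potential g x)%:E)%E.
    transitivity (\int[lebesgue_measure]_(y in `]0%R, 1%R[) (green x y * g y)%:E)%E.
      have m (k : R -> R) : measurable_fun setT k ->
          measurable_fun (`]0%R, 1%R[%classic : set R) (fun y => (green x y * k y)%:E).
        move=> mk; apply/measurable_EFinP; apply: measurable_funTS.
        exact: measurable_green_mul.
      apply: ae_eq_integral => //; [exact: m|exact: m|].
      by apply: filterS ae => y H Dy; have := H Dy => -[->].
    rewrite /potential /Rintegral fineK//; apply: integrable_fin_num => //.
    exact: green_mul_integrable.
  by move=> []; rewrite /optimum; lra.
move=> x; rewrite in_itv/= => /andP[]; rewrite le_eqVlt => /predU1P[<- _|x0].
  (* The representation is silent at the endpoints: continuity from the right settles 0, and the
     common value [xi 1] settles 1. *)
  have [_ E1 _] := (continuous_within_itvP eta (@ltr01 R)).1 Keta.1.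
  have [_ E2 _] := (continuous_within_itvP (optimum b h g) (@ltr01 R)).1 eta0K.1.
  have E3 : eta t @[t --> 0^'+] --> optimum b h g 0.
    apply: cvg_trans (E2); apply: near_eq_cvg; near=> t.
    apply/esym/inner/andP; split; near: t; [exact: nbhs_right_gt|exact: nbhs_right_lt].
  by rewrite -(cvg_lim (@Rhausdorff R) E1) (cvg_lim (@Rhausdorff R) E3).
rewrite le_eqVlt => /predU1P[->|x1]; last by apply: inner; rewrite x0.
by rewrite Keta.2.2.2.1 eta0K.2.2.2.1.
Unshelve. all: by end_near. Qed.
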